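(* Let $G$ be a countable amenable group and fix $A\subset G$. Let $\Phi$ be a two-sided Følner sequence on $G$ such that $\mathsf{d}_\Phi(A)$ exists. For every $\epsilon>0$ there exist a subsequence $\Psi$ of $\Phi$ and a non-principal ultrafilter $\mathfrak{p}$ on $G$ such that $\langle\mathsf{R}^g1_A,\mathsf{R}^{\mathfrak{p}}1_A\rangle_\Psi$ exists for all $g\in G$ and $$\lim_{g\to\mathfrak{p}}\langle\mathsf{R}^g1_A,\mathsf{R}^{\mathfrak{p}}1_A\rangle_\Psi\ \ge\ \langle1,1_A\rangle_\Psi^2-\epsilon.$$
   Context: A two-sided Følner sequence on $G$ is a sequence $\Phi\colon N\mapsto\Phi_N$ of finite non-empty subsets of $G$ with $|(\Phi_Ng)\triangle\Phi_N|/|\Phi_N|\to0$ and $|\Phi_N\triangle(g\Phi_N)|/|\Phi_N|\to0$ for all $g\in G$. $\mathsf{d}_\Phi(A)=\lim_N|A\cap\Phi_N|/|\Phi_N|$. For $f,h\colon G\to\mathbb{C}$, $\langle f,h\rangle_\Phi=\lim_{N\to\infty}\frac{1}{|\Phi_N|}\sum_{g\in\Phi_N}f(g)\overline{h(g)}$ when the limit exists. For bounded $f\colon G\to\mathbb{C}$ and $g\in G$, $(\mathsf{R}^gf)(h)=f(hg)$, and for an ultrafilter $\mathfrak{p}$ on $G$, $(\mathsf{R}^{\mathfrak{p}}f)(h)=\lim_{g\to\mathfrak{p}}f(hg)$ (ultrafilter limit). $1_A$ is the indicator function of $A$.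
   Formalization: The countable group G is assumed to be infinite; on a finite group there is no non-principal ultrafilter, so the claim fails there. *)

(* Defs.v *)
From HB Require Import structures.
From mathcomp Require Import all_boot all_order all_algebra.
From mathcomp Require Import finmap.
From mathcomp Require Import all_classical all_reals topology normedtype sequences.
Import Order.TTheory GRing.Theory Num.Theory.
Import numFieldNormedType.Exports.

Set Implicit Arguments.
Unset Strict Implicit.
Unset Printing Implicit Defensive.

Local Open Scope classical_set_scope.
Local Open Scope ring_scope.


Section Defs.
Variable G : choiceType.
Variables (mul : G -> G -> G) (one : G) (inv : G -> G).

Definition is_group : Prop :=
  [/\ forall x y z, mul x (mul y z) = mul (mul x y) z,
      forall x, mul one x = x /\ mul x one = x &
      forall x, mul (inv x) x = one /\ mul x (inv x) = one].

Definition fsymdiff (A B : {fset G}) : {fset G} := fsetU (fsetD A B) (fsetD B A).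

Definition rtrans (F : {fset G}) (g : G) : {fset G} := [fset mul x g | x in F]%fset.
Definition ltrans (g : G) (F : {fset G}) : {fset G} := [fset mul g x | x in F]%fset.

Variable R : realType.

Definition left_folner (Phi : nat -> {fset G}) : Prop :=
  (forall N, Phi N != fset0%fset) /\
  forall g : G,
    (fun N => (#|` fsymdiff (Phi N) (ltrans g (Phi N))|%:R / #|` Phi N|%:R : R))
      @ \oo --> (0 : R).

Definition amenable : Prop := exists Phi, left_folner Phi.

Definition two_sided_folner (Phi : nat -> {fset G}) : Prop :=
  (forall N, Phi N != fset0%fset) /\
  forall g : G,
    (fun N => (#|` fsymdiff (rtrans (Phi N) g) (Phi N)|%:R / #|` Phi N|%:R : R))
      @ \oo --> (0 : R) /\
    (fun N => (#|` fsymdiff (Phi N) (ltrans g (Phi N))|%:R / #|` Phi N|%:R : R))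
      @ \oo --> (0 : R).

Definition indic (A : set G) (x : G) : R := if `[< A x >] then 1 else 0.

(* finite averages (1/|Phi_N|) sum_{g in Phi_N} f g * conj(h g); functions are real-valued *)
Definition avg_inner (Phi : nat -> {fset G}) (f h : G -> R) (N : nat) : R :=
  (\sum_(x <- Phi N) f x * h x) / #|` Phi N|%:R.

Definition inner_exists (Phi : nat -> {fset G}) (f h : G -> R) : Prop :=
  cvgn (avg_inner Phi f h).

Definition inner (Phi : nat -> {fset G}) (f h : G -> R) : R :=
  limn (avg_inner Phi f h).

Definition density_exists (Phi : nat -> {fset G}) (A : set G) : Prop :=
  cvgn (fun N => (#|` [fset x in Phi N | `[< A x >]]%fset |%:R / #|` Phi N|%:R : R)).

Definition is_ultrafilter (U : set (set G)) : Prop :=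
  [/\ U setT, ~ U set0,
      forall A B, U A -> U B -> U (A `&` B),
      forall A B, A `<=` B -> U A -> U B &
      forall A, U A \/ U (~` A)].

Definition non_principal (U : set (set G)) : Prop := forall x : G, ~ U [set x].

Definition is_ulim (U : set (set G)) (f : G -> R) (l : R) : Prop :=
  forall e : R, 0 < e -> U [set g | `|f g - l| < e].

Definition ulim (U : set (set G)) (f : G -> R) : R := xget 0 [set l | is_ulim U f l].

Definition Rg (g : G) (f : G -> R) : G -> R := fun h => f (mul h g).
Definition Rp (U : set (set G)) (f : G -> R) : G -> R := fun h => ulim U (fun g => f (mul h g)).

Definition subsequence (Psi Phi : nat -> {fset G}) : Prop :=
  exists sigma : nat -> nat, (forall n m, (n < m)%N -> (sigma n < sigma m)%N) /\
    forall N, Psi N = Phi (sigma N).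

End Defs.

(* Main.v *)
(* Write <a, b> = m(ab), where m is the bi-invariant mean obtained from the Folner
   averages along an ultrafilter q, let f = 1_A and d = m(f).  Kernels of the form
   <xi_x, xi_y> satisfy a Cauchy-Schwarz inequality for iterated finitely additive means
   (mean_CS2), which replaces all weak-compactness arguments.

   Among the weak averages of the translates R^x f against bounded densities choose u
   nearly closest to f; it approximates the compact part of f.  Near-minimality gives
   <f - u, R^y f> <= <f - u, u> + small for almost every y, hence, for x in a Bohr-type
   neighbourhood B of the identity where R^x u is close to u,
       <R^x f - u, R^y f - u> <= small   for almost every y.
   Let Q be the mean with density kap, a positive definite kernel supported in B.
   Positivity gives  m_h f(hx) Q_g f(hg) >= d^2 - small  for x near the identity, and
   averaging over x replaces f(hx) by u(h).  Therefore the sets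
       D_N = {g : avg_(Phi_N) u R^g f >= d^2 - small}
   have Q-measure bounded below along q.  By intersectivity, infinitely many of them
   have finite intersections of positive Q-measure, and there is an ultrafilter p
   containing these D_N and every Q-conull set.  Then <u, R^p f> >= d^2 - small along
   the corresponding subsequence, whereas Cauchy-Schwarz for the limit along p bounds
   lim_(g -> p) <R^g f - u, R^p f> by the square root of
   lim_(x -> p) lim_(y -> p) <R^x f - u, R^y f - u>, which is small. *)

Require Import Defs.
From HB Require Import structures.
From mathcomp Require Import all_boot all_order all_algebra.
From mathcomp Require Import finmap.
From mathcomp Require Import all_classical all_reals topology normedtype sequences.
From mathcomp Require Import ring lra.
Import Order.TTheory GRing.Theory Num.Theory.
Import numFieldNormedType.Exports.

Set Implicit Arguments.
Unset Strict Implicit.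
Unset Printing Implicit Defensive.

Local Open Scope classical_set_scope.
Local Open Scope ring_scope.

(** * Finitely additive means *)

Section Bounded.
Variable R : realType.

Definition bnd (T : Type) (f : T -> R) : Prop := exists C, forall x, `|f x| <= C.

Lemma bnd_cst (T : Type) (c : R) : bnd (fun _ : T => c).
Proof. by exists `|c|. Qed.

Lemma bndD (T : Type) (f g : T -> R) :
  bnd f -> bnd g -> bnd (fun x => f x + g x).
Proof.
by move=> [C hC] [D hD]; exists (C + D) => x; apply: (le_trans (ler_normD _ _)); apply: lerD.
Qed.

Lemma bndN (T : Type) (f : T -> R) : bnd f -> bnd (fun x => - f x).
Proof. by move=> [C hC]; exists C => x; rewrite normrN. Qed.

Lemma bndM (T : Type) (f g : T -> R) :
  bnd f -> bnd g -> bnd (fun x => f x * g x).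
Proof.
by move=> [C hC] [D hD]; exists (C * D) => x; rewrite normrM; apply: ler_pM.
Qed.

Lemma bndX (T : Type) (f : T -> R) n : bnd f -> bnd (fun x => f x ^+ n).
Proof.
move=> [C hC]; exists (C ^+ n) => x; rewrite normrX.
by apply: lerXn2r; rewrite ?nnegrE ?(le_trans _ (hC x)).
Qed.

Lemma bnd_sum (T I : Type) (s : seq I) (F : I -> T -> R) :
  (forall i, bnd (F i)) -> bnd (fun x => \sum_(i <- s) F i x).
Proof.
move=> hF; elim: s => [|i s IH].
  by under [fun _ => _]funext do rewrite big_nil; apply: bnd_cst.
by under [fun _ => _]funext do rewrite big_cons; apply: bndD.
Qed.

Lemma bnd_comp (S T : Type) (f : T -> R) (h : S -> T) : bnd f -> bnd (fun x => f (h x)).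
Proof. by move=> [C hC]; exists C. Qed.

Lemma bnd_comp2 (S T U : Type) (F : T -> U -> R) (h : S -> T) (k : S -> U) :
  bnd (fun p : T * U => F p.1 p.2) -> bnd (fun x => F (h x) (k x)).
Proof. by move=> [C hC]; exists C => x; exact: (hC (h x, k x)). Qed.

Lemma bnd_indic (T : choiceType) (A : set T) : bnd (indic R A).
Proof. by exists 1 => x; rewrite /indic; case: ifP; rewrite ?normr1 ?normr0. Qed.

End Bounded.

(* Uniformly bounded families are handled as bounded functions of a pair. *)
Ltac bnd_leaf :=
  match goal with
  | H : bnd ?f |- _ => solve [exact H | apply: (bnd_comp _ H)]
  | H : bnd (fun p => ?F p.1 p.2) |- bnd (fun x => ?F _ _) => apply: (bnd_comp2 _ _ H)
  | H : forall i, bnd (?f i) |- _ => solve [apply: (bnd_comp _ (H _)) | exact: H]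
  | |- bnd (fun x => indic _ ?A _) => apply: (bnd_comp _ (bnd_indic _ A))
  | |- bnd (indic _ ?A) => apply: bnd_indic
  end.

Section Mean.
Variable R : realType.

(** A finitely additive probability, given as a functional. The axioms concern bounded functions
    only, since limits along ultrafilters are guaranteed to exist only for these. *)
Record mean (X : Type) := Mean {
  mean_fun :> (X -> R) -> R;
  meanD : forall f g, bnd f -> bnd g ->
    mean_fun (fun x => f x + g x) = mean_fun f + mean_fun g;
  meanZ : forall c f, bnd f -> mean_fun (fun x => c * f x) = c * mean_fun f;
  mean_ge0 : forall f, bnd f -> (forall x, 0 <= f x) -> 0 <= mean_fun f;
  mean1 : mean_fun (fun _ => 1) = 1 }.

Section Theory.
Variables (X : Type) (mu : mean X).
Implicit Types f g : X -> R.

Lemma eq_mean f g : (forall x, f x = g x) -> mu f = mu g.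
Proof. by move=> /funext ->. Qed.

Lemma mean_cst c : mu (fun _ => c) = c.
Proof.
rewrite -[RHS]mulr1 -(mean1 mu) -meanZ; last exact: bnd_cst.
by apply: eq_mean => x; rewrite mulr1.
Qed.

Lemma meanN f : bnd f -> mu (fun x => - f x) = - mu f.
Proof. by move=> hf; rewrite -mulN1r -meanZ//; apply: eq_mean => x; rewrite mulN1r. Qed.

Lemma meanB f g : bnd f -> bnd g -> mu (fun x => f x - g x) = mu f - mu g.
Proof. by move=> hf hg; rewrite meanD ?meanN//; apply: bndN. Qed.

Lemma meanZr c f : bnd f -> mu (fun x => f x * c) = mu f * c.
Proof. by move=> hf; rewrite mulrC -meanZ//; apply: eq_mean => x; rewrite mulrC. Qed.

Lemma le_mean f g : bnd f -> bnd g -> (forall x, f x <= g x) -> mu f <= mu g.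
Proof.
move=> hf hg h; rewrite -subr_ge0 -meanB//; apply: mean_ge0.
  by apply: bndD => //; apply: bndN.
by move=> x; rewrite subr_ge0.
Qed.

Lemma mean_le_cst f c : bnd f -> (forall x, f x <= c) -> mu f <= c.
Proof. by move=> hf h; rewrite -(mean_cst c); apply: le_mean => //; apply: bnd_cst. Qed.

Lemma mean_ge_cst f c : bnd f -> (forall x, c <= f x) -> c <= mu f.
Proof. by move=> hf h; rewrite -(mean_cst c); apply: le_mean => //; apply: bnd_cst. Qed.

Lemma norm_mean_le f c : (forall x, `|f x| <= c) -> `|mu f| <= c.
Proof.
move=> h; have hf : bnd f by exists c.
rewrite ler_norml; apply/andP; split; [apply: mean_ge_cst|apply: mean_le_cst] => // x.
  by have := h x; rewrite ler_norml => /andP[].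
by have := h x; rewrite ler_norml => /andP[].
Qed.

Lemma mean_sum (I : Type) (s : seq I) (F : I -> X -> R) : (forall i, bnd (F i)) ->
  mu (fun x => \sum_(i <- s) F i x) = \sum_(i <- s) mu (F i).
Proof.
move=> hF; elim: s => [|i s IH].
  by rewrite big_nil -[RHS](mean_cst 0); apply: eq_mean => x; rewrite big_nil.
rewrite big_cons -IH -meanD//; last exact: bnd_sum.
by apply: eq_mean => x; rewrite big_cons.
Qed.

(* A finitely additive mean need not attain its value, whence the slack [e]. *)
Lemma mean_le_ex f e : bnd f -> 0 < e -> exists x, f x <= mu f + e.
Proof.
move=> hf e0; apply: contrapT => /forallNP h.
have : mu f + e <= mu f.
  by apply: mean_ge_cst => // x; have /negP := h x; rewrite -ltNge => /ltW.
by rewrite gerDl leNgt e0.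
Qed.

End Theory.

Lemma bnd_mean (I X : Type) (mu : mean X) (F : I -> X -> R) :
  bnd (fun p : I * X => F p.1 p.2) -> bnd (fun i => mu (F i)).
Proof. by move=> [C hC]; exists C => i; apply: norm_mean_le => x; exact: (hC (i, x)). Qed.

End Mean.

(** Each use of linearity leaves boundedness side conditions; they are discharged by recursion on
    the integrand. *)
Ltac bnd_tac := cbv beta;
  match goal with
  | H : ?P |- ?P => exact: H
  | |- bnd (fun x => _ + _) => apply: bndD; bnd_tac
  | |- bnd (fun x => - _) => apply: bndN; bnd_tac
  | |- bnd (fun x => _ * _) => apply: bndM; bnd_tac
  | |- bnd (fun x => _ ^+ _) => apply: bndX; bnd_tac
  | |- bnd (fun x => mean_fun ?m _) => apply: bnd_mean; bnd_tac
  | |- bnd (fun x => \sum_(i <- _) _) => apply: bnd_sum => ?; bnd_tac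
  | |- bnd (fun x => _) => solve [apply: bnd_cst]
  | |- _ => bnd_leaf
  | |- forall _, _ => move=> ?; bnd_tac
  end.

(** * Cauchy-Schwarz and Mazur for iterated means *)

Section CauchySchwarz.
Variable R : realType.

(** Evaluate the quadratic at its vertex [- B / C]. The case [C = 0] must be allowed, as [mean_CS2]
    takes for [C] the mean of a square. *)
Lemma discriminant_le (A B C : R) : 0 <= C ->
  (forall t, 0 <= A + 2 * t * B + t ^+ 2 * C) -> B ^+ 2 <= C * A.
Proof.
move=> C0 h; have [Cp|] := ltP 0 C.
  have := h (- B / C).
  have -> : A + 2 * (- B / C) * B + (- B / C) ^+ 2 * C = (C * A - B ^+ 2) / C.
    by field; rewrite gt_eqF.
  by rewrite pmulr_lge0 ?invr_gt0// subr_ge0.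
move=> C0'; have C00 : C = 0 by apply/eqP; rewrite eq_le C0 C0'.
subst C; rewrite mul0r; have [->|B0] := eqVneq B 0; first by rewrite expr0n.
(* With [C = 0] the expression is affine in [t]; for nonzero [B] this [t] gives it the value -1. *)
have := h (- (A + 1) / (2 * B)).
have -> : A + 2 * (- (A + 1) / (2 * B)) * B + (- (A + 1) / (2 * B)) ^+ 2 * 0 = -1.
  by field.
by rewrite lerNr oppr0 ler10.
Qed.

Section Kernel.
Variables (I : Type) (Q : mean R I) (N : I -> I -> R) (C : R).
Hypothesis NC : forall x y, `|N x y| <= C.
Hypothesis Nsym : forall x y, N x y = N y x.

Let energy s := \sum_(x <- s) \sum_(y <- s) N x y.

Lemma energy_cons x s : energy (x :: s) = N x x + 2 * \sum_(y <- s) N y x + energy s.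
Proof.
rewrite /energy big_cons big_cons.
under [X in _ + X]eq_bigr do rewrite big_cons.
rewrite big_split /= addrA; congr (_ + _).
under [X in _ + X + _ = _]eq_bigr do rewrite Nsym.
by ring.
Qed.

(* The indices are picked one at a time by the method of conditional expectations. *)
Lemma energy_select p s : exists2 s', size s' = p &
  energy (s' ++ s) <= energy s + 2 * p%:R * (\sum_(x <- s) Q (fun y => N x y))
    + p%:R * (p%:R - 1) * Q (fun x => Q (fun y => N x y)) + p%:R * (C + 1).
Proof.
have bN2 : bnd (fun p : I * I => N p.1 p.2) by exists C.
have bN x : bnd (N x) by exists C.
have bN' y : bnd (fun x => N x y) by exists C.
elim: p s => [|p IH] s.
  by exists [::] => //=; lra.
(* The part of the bound that depends on the new index [x], apart from [N x x], which is at most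
   [C]. Some [x] brings it within 1 of its mean, whence the cost [C + 1] per index. *)
pose F x := 2 * (\sum_(y <- s) N y x) + 2 * p%:R * Q (fun y => N x y).
have bF : bnd F by rewrite /F; bnd_tac.
have [x hx] := mean_le_ex Q bF ltr01.
have QF : Q F = 2 * (\sum_(y <- s) Q (fun x => N y x))
    + 2 * p%:R * Q (fun x => Q (fun y => N x y)).
  by rewrite /F meanD ?meanZ ?mean_sum; [ |bnd_tac..].
have [s' ss' hs'] := IH (x :: s).
exists (rcons s' x); first by rewrite size_rcons ss'.
rewrite cat_rcons; apply: (le_trans hs').
rewrite energy_cons big_cons.
have : N x x <= C by apply: le_trans (NC x x); apply: ler_norm.
move: hx; rewrite QF /F -natr1.
set a := Q (fun y => N x y); set b := \sum_(y <- s) Q _; set c := Q (fun x => Q _).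
set d := \sum_(y <- s) N y x.
move=> h1 h2; nra.
Qed.

Lemma kernel_select p : exists2 s, size s = p &
  \sum_(x <- s) \sum_(y <- s) N x y
    <= p%:R * (p%:R - 1) * Q (fun x => Q (fun y => N x y)) + p%:R * (C + 1).
Proof.
have [s ss h] := energy_select p [::]; exists s => //.
by move: h; rewrite cats0 /energy !big_nil mulr0 addr0 add0r.
Qed.

(** If the iterated mean were negative, [kernel_select] would bound the sum over a suitable list of
    length [p] by a negative multiple of [p * (p - 1)] plus an error linear in [p], which is
    negative for large [p]. *)
Lemma psd_mean2_ge0 : (forall s, 0 <= \sum_(x <- s) \sum_(y <- s) N x y) ->
  0 <= Q (fun x => Q (fun y => N x y)).
Proof.
move=> psd; set q := Q _; rewrite leNgt; apply/negP => q0.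
pose n := Num.bound ((C + 1) / - q).
have [s ss h] := kernel_select n.+2.
have := le_trans (psd s) h.
rewrite -/q -mulrA -mulrDr pmulr_rge0 ?ltr0Sn// -natr1 addrK.
have : (C + 1) / - q < n%:R.
  by rewrite /n; apply: archi_boundP; apply: divr_ge0; [have := NC; case: s ss h => // x s _ _ /(_ x x) | lra]; have := normr_ge0 (N x x); lra.
rewrite ltr_pdivrMr; last by lra.
rewrite -natr1; nra.
Qed.

End Kernel.

(** This is a Gram kernel: its sum over a finite list is the mean of the square of a sum. *)
Lemma mean2_ge0 (I X : Type) (Q : mean R I) (mu : mean R X) (xi : I -> X -> R) :
  bnd (fun p : I * X => xi p.1 p.2) ->
  0 <= Q (fun x => Q (fun y => mu (fun z => xi x z * xi y z))).
Proof.
move=> hxi; have hx x : bnd (xi x) by case: hxi => C hC; exists C => z; exact: (hC (x, z)).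
case: (hxi) => C hC.
apply: (@psd_mean2_ge0 _ _ (fun x y => mu (fun z => xi x z * xi y z)) (C * C)).
- move=> x y; apply: norm_mean_le => z; rewrite normrM.
  by apply: ler_pM => //; [exact: (hC (x, z)) | exact: (hC (y, z))].
- by move=> x y; apply: eq_mean => z; rewrite mulrC.
move=> s.
suff -> : \sum_(x <- s) \sum_(y <- s) mu (fun z => xi x z * xi y z)
    = mu (fun z => (\sum_(x <- s) xi x z) ^+ 2).
  by apply: mean_ge0; [bnd_tac | move=> z; apply: sqr_ge0].
transitivity (\sum_(x <- s) mu (fun z => \sum_(y <- s) xi x z * xi y z)).
  by apply: eq_bigr => x _; rewrite mean_sum; last by bnd_tac.
rewrite -mean_sum; last by bnd_tac.
by apply: eq_mean => z; rewrite expr2 mulr_suml; apply: eq_bigr => x _; rewrite mulr_sumr.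
Qed.

(** Cauchy-Schwarz for [v] and the weak integral of [xi] against [Q]. That integral need not be a
    function; the iterated mean stands for its squared norm. The quadratic in [t] is [mean2_ge0] for
    the family [xi x + t * v]. *)
Lemma mean_CS2 (I X : Type) (Q : mean R I) (mu : mean R X) (xi : I -> X -> R) (v : X -> R) :
  bnd (fun p : I * X => xi p.1 p.2) -> bnd v ->
  Q (fun x => mu (fun z => v z * xi x z)) ^+ 2 <=
  mu (fun z => v z ^+ 2) * Q (fun x => Q (fun y => mu (fun z => xi x z * xi y z))).
Proof.
move=> hxi hv.
have hx x : bnd (xi x) by case: hxi => C hC; exists C => z; exact: (hC (x, z)).
apply: discriminant_le; first by apply: mean_ge0; [bnd_tac | move=> z; apply: sqr_ge0].
move=> t.
have : bnd (fun p : I * X => xi p.1 p.2 + t * v p.2) by bnd_tac.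
move=> /(@mean2_ge0 _ _ Q mu (fun x z => xi x z + t * v z)) h.
apply: (le_trans h); rewrite le_eqVlt; apply/orP; left; apply/eqP; clear h.
have e1 x y : mu (fun z => (xi x z + t * v z) * (xi y z + t * v z)) =
    mu (fun z => xi x z * xi y z) + (t * mu (fun z => v z * xi x z)
    + (t * mu (fun z => v z * xi y z) + t ^+ 2 * mu (fun z => v z ^+ 2))).
  rewrite -!meanZ -?meanD; [|bnd_tac..].
  by apply: eq_mean => z; ring.
transitivity (Q (fun x => Q (fun y => mu (fun z => xi x z * xi y z))
    + (t * mu (fun z => v z * xi x z)
    + (t * Q (fun y => mu (fun z => v z * xi y z)) + t ^+ 2 * mu (fun z => v z ^+ 2))))).
  apply: eq_mean => x; rewrite (eq_mean _ (e1 x)).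
  by rewrite !meanD ?mean_cst ?meanZ; [ |bnd_tac..].
rewrite !meanD ?meanZ ?mean_cst; [ |bnd_tac..].
by ring.
Qed.

Lemma mean_CS (X : Type) (mu : mean R X) (v w : X -> R) : bnd v -> bnd w ->
  mu (fun z => v z * w z) ^+ 2 <= mu (fun z => v z ^+ 2) * mu (fun z => w z ^+ 2).
Proof.
move=> hv hw.
have hw2 : bnd (fun p : X * X => w p.2) by bnd_tac.
have := @mean_CS2 _ _ mu mu (fun _ => w) v hw2 hv.
rewrite !mean_cst.
by under [X in _ <= _ * mu X -> _]funext do rewrite -expr2.
Qed.

End CauchySchwarz.

(** * Iterated and weighted means *)

Section MeanConstructions.
Variable R : realType.

(** The order of iteration is fixed, since finitely additive means need not commute. *)
Definition mean_prod (X Y : Type) (mu : mean R X) (nu : mean R Y) : mean R (X * Y).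
Proof.
refine (@Mean R (X * Y) (fun f => mu (fun x => nu (fun y => f (x, y)))) _ _ _ _).
- move=> f g hf hg; rewrite -meanD; [ |bnd_tac..].
  by apply: eq_mean => x; rewrite meanD; [ |bnd_tac..].
- move=> c f hf; rewrite -meanZ; [ |bnd_tac].
  by apply: eq_mean => x; rewrite meanZ; [ |bnd_tac].
- move=> f hf f0; apply: mean_ge0; first by bnd_tac.
  by move=> x; apply: mean_ge0; [bnd_tac|].
- by rewrite !mean_cst.
Defined.

Definition weighted_mean (X : Type) (mu : mean R X) (k : X -> R)
  (hk : bnd k) (k0 : forall x, 0 <= k x) (k1 : mu k = 1) : mean R X.
Proof.
refine (@Mean R X (fun f => mu (fun x => k x * f x)) _ _ _ _).
- move=> f g hf hg; rewrite -meanD; [ |bnd_tac..].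
  by apply: eq_mean => x; rewrite mulrDr.
- move=> c f hf; rewrite -meanZ; [ |bnd_tac].
  by apply: eq_mean => x; rewrite mulrCA.
- by move=> f hf f0; apply: mean_ge0 => [|x]; [bnd_tac | apply: mulr_ge0].
- by rewrite -[RHS]k1; apply: eq_mean => x; rewrite mulr1.
Defined.

End MeanConstructions.

(** * Finite averages in place of weak integrals, and exchange of means *)

Section Mazur.
Variable R : realType.

Lemma norm_le_of_sqr (a b : R) : 0 <= b -> a ^+ 2 <= b ^+ 2 -> `|a| <= b.
Proof. by move=> b0 h; rewrite ler_norml; apply/andP; split; nra. Qed.

Definition savg (I X : Type) (s : seq I) (xi : I -> X -> R) (z : X) : R :=
  (\sum_(x <- s) xi x z) / (size s)%:R.

Lemma savg_itv (I X : Type) (s : seq I) (xi : I -> X -> R) a b z : s <> [::] ->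
  (forall x z, a <= xi x z <= b) -> a <= savg s xi z <= b.
Proof.
move=> s0 h.
have sp : 0 < (size s)%:R :> R by rewrite ltr0n; case: s s0.
rewrite /savg ler_pdivlMr// ler_pdivrMr//; apply/andP.
elim: s {s0 sp} => [|x s [IH1 IH2]]; first by rewrite big_nil !mulr0.
rewrite big_cons /= -natr1 !mulrDr !mulr1.
by have /andP[h1 h2] := h x z; split; rewrite addrC; apply: lerD.
Qed.

Lemma mean_mul_savg (I X : Type) (mu : mean R X) (s : seq I) (xi : I -> X -> R) v :
  (forall x, bnd (xi x)) -> bnd v ->
  mu (fun z => v z * savg s xi z) = (\sum_(x <- s) mu (fun z => v z * xi x z)) / (size s)%:R.
Proof.
move=> hx hv; rewrite -mean_sum; last by bnd_tac.
rewrite -meanZr; last by bnd_tac.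
by apply: eq_mean => z; rewrite /savg mulrA mulr_sumr.
Qed.

(* A quantitative Mazur theorem: the weak integral of [xi] against [Q], which need
   not be a function on [X], is approximated uniformly over the test functions [v]
   by a finite average. *)
Lemma mean_mazur (I X : Type) (Q : mean R I) (mu : mean R X) (xi : I -> X -> R) (d : R) :
  (forall x z, `|xi x z| <= 1) -> 0 < d ->
  exists2 s : seq I, s <> [::] & forall v, (forall z, `|v z| <= 1) ->
    `|Q (fun x => mu (fun z => v z * xi x z)) - mu (fun z => v z * savg s xi z)| <= d.
Proof.
move=> xi1 d0.
have hxi : bnd (fun p : I * X => xi p.1 p.2) by exists 1 => p.
have hx x : bnd (xi x) by exists 1.
pose K x y := mu (fun z => xi x z * xi y z).
have K1 x y : `|K x y| <= 1.
  by apply: norm_mean_le => z; rewrite normrM mulr_ile1.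
have Ksym x y : K x y = K y x by apply: eq_mean => z; rewrite mulrC.
have hK : bnd (fun p : I * I => K p.1 p.2) by exists 1 => p.
pose A x := Q (K x).
have hA : bnd A by rewrite /A; bnd_tac.
have A1 x : `|A x| <= 1 by apply: norm_mean_le.
pose B := Q A.
have B1 : `|B| <= 1 by apply: norm_mean_le.
(* The Gram kernel of the [xi x] centred at their weak integral. Its mean in [y] vanishes, so
   [kernel_select] bounds the energy of a sample linearly in its size. *)
pose N x y := K x y - A x - A y + B.
have N4 x y : `|N x y| <= 4.
  rewrite /N ler_norml; move: (K1 x y) (A1 x) (A1 y) B1.
  rewrite !ler_norml => /andP[? ?] /andP[? ?] /andP[? ?] /andP[? ?].
  by apply/andP; split; lra.
have Nsym x y : N x y = N y x by rewrite /N Ksym; ring.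
have QN x : Q (N x) = 0.
  have hKx : bnd (K x) by exists 1.
  by rewrite /N meanD ?mean_cst ?meanB ?mean_cst -/B -/(A x); [ring|bnd_tac..].
(* As [N] is bounded by 4, a sample of [n.+1] points has energy at most [5 * n.+1], hence at most
   [d ^+ 2] after division by the square of [n.+1]. *)
pose n := Num.bound (5 / d ^+ 2).
have [s ss] := kernel_select Q N4 Nsym n.+1.
rewrite (_ : Q (fun x => Q (N x)) = 0); last first.
  by rewrite -[RHS](mean_cst Q); apply: eq_mean => x.
rewrite mulr0 add0r => hs.
exists s; first by case: s ss {hs}.
move=> v v1; have hv : bnd v by exists 1.
set u := savg s xi.
have hu : bnd u by rewrite /u /savg; bnd_tac.
have -> : Q (fun x => mu (fun z => v z * xi x z)) - mu (fun z => v z * u z)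
   = Q (fun x => mu (fun z => v z * (xi x z - u z))).
  rewrite -[X in _ - X](mean_cst Q) -meanB; [ |bnd_tac..].
  apply: eq_mean => x; rewrite -meanB; [ |bnd_tac..].
  by apply: eq_mean => z; ring.
apply: norm_le_of_sqr; first exact: ltW.
have hxu : bnd (fun p : I * X => xi p.1 p.2 - u p.2) by bnd_tac.
apply: (le_trans (mean_CS2 Q mu hxu hv)).
(* The squared distance from the weak integral to the sample average [u] is the normalised centred
   energy of the sample. *)
have V : Q (fun x => Q (fun y => mu (fun z => (xi x z - u z) * (xi y z - u z)))) =
    (\sum_(x <- s) \sum_(y <- s) N x y) / (n.+1)%:R ^+ 2.
  have e1 x y : mu (fun z => (xi x z - u z) * (xi y z - u z)) =
     K x y - mu (fun z => u z * xi x z) - mu (fun z => u z * xi y z) + mu (fun z => u z * u z).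
    by rewrite -!meanB -?meanD; [apply: eq_mean => z; ring|bnd_tac..].
  pose a := Q (fun x => mu (fun z => u z * xi x z)).
  transitivity (Q (fun x => A x - mu (fun z => u z * xi x z) - a + mu (fun z => u z * u z))).
    apply: eq_mean => x; rewrite (eq_mean _ (e1 x)).
    have hKx : bnd (K x) by exists 1.
    by rewrite meanD ?meanB ?mean_cst//; bnd_tac.
  rewrite meanD ?meanB ?mean_cst -/a -/B; [ |bnd_tac..].
  have sz : (size s)%:R = (n.+1)%:R :> R by rewrite ss.
  have muu w : bnd w -> mu (fun z => u z * w z)
      = (\sum_(x <- s) mu (fun z => xi x z * w z)) / n.+1%:R.
    move=> hw; rewrite -sz.
    transitivity (mu (fun z => w z * u z)); first by apply: eq_mean => z; rewrite mulrC.
    rewrite mean_mul_savg//; congr (_ / _).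
    by apply: eq_bigr => x _; apply: eq_mean => z; rewrite mulrC.
  have ea : a = (\sum_(x <- s) A x) / n.+1%:R.
    rewrite /a -mean_sum; last by move=> x; exists 1 => y.
    rewrite -meanZr; last by apply: bnd_sum => x; exists 1 => y.
    by apply: eq_mean => y; rewrite muu.
  have euu : mu (fun z => u z * u z) = (\sum_(x <- s) \sum_(y <- s) K x y) / n.+1%:R ^+ 2.
    rewrite muu// expr2 invfM mulrA; congr (_ / _); rewrite mulr_suml.
    apply: eq_bigr => x _.
    transitivity (mu (fun z => u z * xi x z)); first by apply: eq_mean => z; rewrite mulrC.
    by rewrite muu//; congr (_ / _); apply: eq_bigr => y _; rewrite -Ksym.
  have eN : \sum_(x <- s) \sum_(y <- s) N x y = (\sum_(x <- s) \sum_(y <- s) K x y)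
     - 2 * n.+1%:R * (\sum_(x <- s) A x) + n.+1%:R ^+ 2 * B.
    have c1 (c : R) : \sum_(x <- s) c = n.+1%:R * c.
      by rewrite big_const_seq count_predT ss iter_addr_0 mulr_natl.
    under eq_bigr do rewrite /N big_split !sumrB /= !c1.
    by rewrite big_split !sumrB /= !c1 -mulr_sumr; ring.
  rewrite eN euu ea; have : n.+1%:R != 0 :> R by rewrite pnatr_eq0.
  by move: n.+1%:R => c c0; field.
rewrite V -[X in _ <= X]mul1r; apply: ler_pM.
- by apply: mean_ge0; [bnd_tac|move=> z; apply: sqr_ge0].
- rewrite -V; apply: mean2_ge0 hxu.
- apply: mean_le_cst; first by bnd_tac.
  by move=> z; rewrite -real_normK ?num_real// expr_le1.
have np : 0 < n.+1%:R :> R by rewrite ltr0n.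
rewrite ler_pdivrMr ?exprn_gt0//; apply: (le_trans hs).
rewrite expr2 mulrCA ler_pM2l// (_ : 4 + 1 = 5); last by ring.
have : 5 / d ^+ 2 < n%:R by apply: archi_boundP; rewrite divr_ge0 ?sqr_ge0.
rewrite ltr_pdivrMr ?exprn_gt0// => /ltW/le_trans; apply.
by rewrite mulrC ler_pM2l ?exprn_gt0// ler_nat.
Qed.

(** Means may be exchanged when the kernel is an inner product: by [mean_mazur] each family can be
    replaced by a finite average, uniformly over the test functions, and both iterated means are
    then close to the same number [c]. *)
Lemma mean_swap (I J X : Type) (P : mean R I) (Q : mean R J) (mu : mean R X)
    (xi : I -> X -> R) (eta : J -> X -> R) :
  (forall x z, `|xi x z| <= 1) -> (forall x z, `|eta x z| <= 1) ->
  P (fun x => Q (fun y => mu (fun z => xi x z * eta y z))) =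
  Q (fun y => P (fun x => mu (fun z => xi x z * eta y z))).
Proof.
move=> x1 e1; apply/eqP; rewrite -subr_eq0 -normr_le0; apply/ler_addgt0Pl => e e0.
rewrite addr0.
have hxi : bnd (fun p : I * X => xi p.1 p.2) by exists 1 => p.
have heta : bnd (fun p : J * X => eta p.1 p.2) by exists 1 => p.
have hx x : bnd (xi x) by exists 1.
have he x : bnd (eta x) by exists 1.
have d0 : 0 < e / 4 by rewrite divr_gt0.
have [s s0 hs] := mean_mazur P mu x1 d0.
have [t t0 ht] := mean_mazur Q mu e1 d0.
have s1 z : `|savg s xi z| <= 1.
  by rewrite ler_norml; apply: savg_itv => // x y; rewrite -ler_norml.
have t1 z : `|savg t eta z| <= 1.
  by rewrite ler_norml; apply: savg_itv => // x y; rewrite -ler_norml.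
have bs : bnd (savg s xi) by exists 1.
have bt : bnd (savg t eta) by exists 1.
pose c := mu (fun z => savg s xi z * savg t eta z).
have h1 : `|P (fun x => Q (fun y => mu (fun z => xi x z * eta y z))) - c| <= e / 2.
  rewrite (_ : _ - _ = P (fun x => Q (fun y => mu (fun z => xi x z * eta y z))
      - mu (fun z => xi x z * savg t eta z)) + (P (fun x => mu (fun z => savg t eta z * xi x z)) - c)).
    apply: (le_trans (ler_normD _ _)).
    rewrite (_ : e / 2 = e / 4 + e / 4); last by field.
    apply: lerD; first by apply: norm_mean_le => x; apply: ht.
    rewrite /c (eq_mean _ (g := fun z => savg t eta z * savg s xi z)); last by move=> z; rewrite mulrC.
    exact: hs.
  rewrite meanB; [ |bnd_tac..].
  rewrite (eq_mean P (f := fun x => mu (fun z => savg t eta z * xi x z))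
    (g := fun x => mu (fun z => xi x z * savg t eta z))); first by ring.
  by move=> x; apply: eq_mean => z; rewrite mulrC.
have h2 : `|Q (fun y => P (fun x => mu (fun z => xi x z * eta y z))) - c| <= e / 2.
  rewrite (_ : _ - _ = Q (fun y => P (fun x => mu (fun z => eta y z * xi x z))
      - mu (fun z => eta y z * savg s xi z)) + (Q (fun y => mu (fun z => savg s xi z * eta y z)) - c)).
    apply: (le_trans (ler_normD _ _)).
    rewrite (_ : e / 2 = e / 4 + e / 4); last by field.
    by apply: lerD; [apply: norm_mean_le => x; apply: hs|exact: ht].
  rewrite meanB; [ |bnd_tac..].
  rewrite (eq_mean Q (f := fun x => mu (fun z => savg s xi z * eta x z))
    (g := fun x => mu (fun z => eta x z * savg s xi z))); last first.
    by move=> x; apply: eq_mean => z; rewrite mulrC.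
  rewrite addrA subrK; congr (_ - _); apply: eq_mean => y; apply: eq_mean => x.
  by apply: eq_mean => z; rewrite mulrC.
by move: h1 h2; rewrite !ler_norml => /andP[? ?] /andP[? ?]; apply/andP; split; lra.
Qed.

End Mazur.

(** * Indicators and means conditioned on a set of positive mean *)

Section CondMean.
Variables (R : realType) (T : choiceType) (mu : mean R T).
Implicit Type A B : set T.

Lemma indic_in A x : A x -> indic R A x = 1.
Proof. by move=> Ax; rewrite /indic; case: asboolP. Qed.

Lemma indic_notin A x : ~ A x -> indic R A x = 0.
Proof. by move=> Ax; rewrite /indic; case: asboolP. Qed.

Lemma indic_itv A x : 0 <= indic R A x <= 1.
Proof. by rewrite /indic; case: ifP; rewrite lexx ler01. Qed.

Lemma indic_ge0 A x : 0 <= indic R A x.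
Proof. by have /andP[] := indic_itv A x. Qed.

Lemma indic_le1 A x : indic R A x <= 1.
Proof. by have /andP[] := indic_itv A x. Qed.

Lemma mean_indic_ge0 A : 0 <= mu (indic R A).
Proof. by apply: mean_ge0 => [|x]; [bnd_tac|exact: indic_ge0]. Qed.

Lemma le_mean_indic A B : A `<=` B -> mu (indic R A) <= mu (indic R B).
Proof.
move=> AB; apply: le_mean => [||x]; [bnd_tac..|].
have [Ax|Ax] := pselect (A x); first by rewrite !indic_in//; exact: AB.
by rewrite (indic_notin Ax) indic_ge0.
Qed.

Lemma mean_indicU A B : mu (indic R (A `|` B)) <= mu (indic R A) + mu (indic R B).
Proof.
rewrite -meanD; [ |bnd_tac..]; apply: le_mean => [||x]; [bnd_tac..|].
have [Ax|Ax] := pselect (A x).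
  by rewrite (indic_in Ax) (le_trans (indic_le1 _ _))// lerDl indic_ge0.
have [Bx|Bx] := pselect (B x).
  by rewrite (indic_in Bx) (le_trans (indic_le1 _ _))// lerDr indic_ge0.
by rewrite (indic_notin (A := A `|` B)) ?addr_ge0 ?indic_ge0//; case.
Qed.

Lemma mean_indic_ex A : 0 < mu (indic R A) -> exists x, A x.
Proof.
move=> A0; apply: contrapT => /forallNP h; move: A0.
rewrite (eq_mean _ (g := fun=> 0)) ?mean_cst ?ltxx// => x.
by rewrite indic_notin.
Qed.

Section Density.
Variable A : set T.
Hypothesis A0 : 0 < mu (indic R A).

Definition density (x : T) : R := indic R A x / mu (indic R A).

Lemma bnd_density : bnd density. Proof. by rewrite /density; bnd_tac. Qed.

Lemma density_ge0 x : 0 <= density x.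
Proof. by rewrite divr_ge0 ?indic_ge0 ?ltW. Qed.

Lemma mean_density : mu density = 1.
Proof. by rewrite /density meanZr ?divff ?gt_eqF//; bnd_tac. Qed.

Definition cond_mean : mean R T := weighted_mean bnd_density density_ge0 mean_density.

Lemma cond_mean_ge (g : T -> R) c : bnd g -> (forall x, A x -> c <= g x) -> c <= cond_mean g.
Proof.
have bd := bnd_density.
move=> hg h; rewrite -(mean_cst cond_mean c) /=; apply: le_mean => [||x]; [bnd_tac..|].
have [Ax|Ax] := pselect (A x); first by rewrite ler_wpM2l ?density_ge0// h.
by rewrite /density (indic_notin Ax) !mul0r.
Qed.

Lemma cond_mean_le (g : T -> R) c : bnd g -> (forall x, A x -> g x <= c) -> cond_mean g <= c.
Proof.
move=> hg h; rewrite -lerN2 -meanN//; apply: cond_mean_ge; first by bnd_tac.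
by move=> x /h; rewrite lerN2.
Qed.

End Density.
End CondMean.

(** * The compact part and Bohr neighbourhoods *)

Section NearMinimizer.
Variables (R : realType) (G : choiceType) (mul : G -> G -> G) (m : mean R G).
Variable f : G -> R.
Hypothesis f01 : forall x, 0 <= f x <= 1.

Let bf : bnd f.
Proof. by exists 1 => x; have /andP[? ?] := f01 x; rewrite ger0_norm. Qed.

(* [u] stands for the weak integral of the translates [R^x f] against the density [k]. *)
Definition translate_mean (d : R) (k u : G -> R) : Prop :=
  [/\ bnd k, forall x, 0 <= k x, m k = 1 &
   forall v, (forall z, `|v z| <= 1) ->
    `|m (fun x => k x * m (fun z => v z * Rg mul x f z)) - m (fun z => v z * u z)| <= d].

(** The candidates for the compact part of [f]. The tolerance [d] lets a genuine function replace a
    weak integral, and the set is still convex. *)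
Definition admissible (d : R) (u : G -> R) : Prop :=
  (forall z, 0 <= u z <= 1) /\ exists k, translate_mean d k u.

(** Mazur's theorem for the mean of density [k] supplies a finite average of translates of [f]. *)
Lemma translate_mean_ex d k : 0 < d -> bnd k -> (forall x, 0 <= k x) -> m k = 1 ->
  exists2 u : G -> R, (forall z, 0 <= u z <= 1) & translate_mean d k u.
Proof.
move=> d0 hk k0 k1.
have h1 x z : `|Rg mul x f z| <= 1.
  by rewrite /Rg; have /andP[? ?] := f01 (mul z x); rewrite ger0_norm.
have [s s0 hs] := mean_mazur (weighted_mean hk k0 k1) m h1 d0.
exists (savg s (fun x => Rg mul x f)) => [z|]; last by split.
by apply: savg_itv => // x y; exact: f01.
Qed.

(** Functions and densities are mixed with the same weights, so the errors are mixed too and the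
    tolerance does not grow. *)
Lemma admissible_conv d t u w : 0 <= t <= 1 -> admissible d u -> admissible d w ->
  admissible d (fun z => (1 - t) * u z + t * w z).
Proof.
move=> /andP[t0 t1] [u01 [k [bk k0 k1 hk]]] [w01 [l [bl l0 l1 hl]]]; split.
  by move=> z; have /andP[? ?] := u01 z; have /andP[? ?] := w01 z; apply/andP; split; nra.
exists (fun x => (1 - t) * k x + t * l x); split.
- by bnd_tac.
- by move=> x; rewrite addr_ge0// mulr_ge0// subr_ge0.
- by rewrite meanD ?meanZ ?k1 ?l1; [ring|bnd_tac..].
move=> v v1; have bv : bnd v by exists 1.
have bu : bnd u by exists 1 => x; have /andP[? ?] := u01 x; rewrite ger0_norm.
have bw : bnd w by exists 1 => x; have /andP[? ?] := w01 x; rewrite ger0_norm.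
pose F x := m (fun z => v z * Rg mul x f z).
have bF : bnd F by rewrite /F /Rg; bnd_tac.
have -> : m (fun x => ((1 - t) * k x + t * l x) * F x) - m (fun z => v z * ((1 - t) * u z + t * w z))
   = (1 - t) * (m (fun x => k x * F x) - m (fun z => v z * u z))
     + t * (m (fun x => l x * F x) - m (fun z => v z * w z)).
  rewrite !mulrBr -!meanZ; [ |bnd_tac..].
  rewrite addrACA -opprD -!meanD; [ |bnd_tac..].
  by congr (_ - _); apply: eq_mean => z; ring.
apply: (le_trans (ler_normD _ _)); rewrite !normrM (ger0_norm t0) ger0_norm ?subr_ge0//.
rewrite (_ : d = (1 - t) * d + t * d); last by ring.
by apply: lerD; apply: ler_wpM2l; rewrite ?subr_ge0//; [apply: hk|apply: hl].
Qed.

(** The infimum need not be attained. The slack [d ^+ 2 / 2] is smaller than the gain that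
    [near_minimizer_null] would produce. *)
Lemma near_minimizer d : 0 < d -> exists2 u, admissible d u &
  forall w, admissible d w ->
    m (fun z => (f z - u z) ^+ 2) <= m (fun z => (f z - w z) ^+ 2) + d ^+ 2 / 2.
Proof.
move=> d0; pose S : set R := [set m (fun z => (f z - u z) ^+ 2) | u in admissible d].
have S0 : has_inf S.
  split.
    have [u u01 hu] := @translate_mean_ex d (fun=> 1) d0 (bnd_cst _ 1) (fun=> ler01) (mean1 m).
    by exists (m (fun z => (f z - u z) ^+ 2)); exists u => //; split => //; exists (fun=> 1).
  exists 0 => _ [u [u01 _] <-]; apply: mean_ge0 => [|x]; last exact: sqr_ge0.
  have bu : bnd u by exists 1 => x; have /andP[? ?] := u01 x; rewrite ger0_norm.
  by bnd_tac.
have e0 : 0 < d ^+ 2 / 2 by rewrite divr_gt0 ?exprn_gt0.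
have [_ [u hu <-] ltu] := inf_adherent e0 S0.
exists u => // w hw; apply: (le_trans (ltW ltu)); rewrite lerD2r.
by apply: ge_inf; [exact: S0.2 | exists w].
Qed.

(* If the set were not null, mixing a little of the average of the translates over it
   into [u] would bring [u] closer to [f]. *)
Lemma near_minimizer_null d u : 0 < d <= 1 -> admissible d u ->
  (forall w, admissible d w ->
    m (fun z => (f z - u z) ^+ 2) <= m (fun z => (f z - w z) ^+ 2) + d ^+ 2 / 2) ->
  m (indic R [set y | m (fun z => (f z - u z) * u z) + 2 * d
                      < m (fun z => (f z - u z) * Rg mul y f z)]) = 0.
Proof.
move=> /andP[d0 d1] au umin; set A := [set y | _].
apply/eqP; rewrite eq_le mean_indic_ge0 andbT leNgt; apply/negP => A0.
have [w w01 hw] := translate_mean_ex d0 (bnd_density m A) (density_ge0 A0) (mean_density A0).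
have aw : admissible d w by split => //; exists (density m A).
(* Mix with weight [d]. The inner product of [f - u] with [w - u] is at least [2 * d - d], so the
   squared distance falls by at least [2 * d ^+ 2 - d ^+ 2], more than the slack. *)
have := umin _ (admissible_conv (t := d) _ au aw); rewrite (ltW d0) d1 => /(_ isT).
have [u01 _] := au.
have bu : bnd u by exists 1 => x; have /andP[? ?] := u01 x; rewrite ger0_norm.
have bw : bnd w by exists 1 => x; have /andP[? ?] := w01 x; rewrite ger0_norm.
have e1 : m (fun z => (f z - ((1 - d) * u z + d * w z)) ^+ 2) =
   m (fun z => (f z - u z) ^+ 2) - 2 * d * (m (fun z => (f z - u z) * w z)
    - m (fun z => (f z - u z) * u z)) + d ^+ 2 * m (fun z => (w z - u z) ^+ 2).
  rewrite -meanB -?meanZ -?meanB -?meanD; [ |bnd_tac..].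
  by apply: eq_mean => z; ring.
have e2 : m (fun z => (w z - u z) ^+ 2) <= 1.
  apply: mean_le_cst; first by bnd_tac.
  by move=> z; have /andP[? ?] := u01 z; have /andP[? ?] := w01 z; nra.
have v1 z : `|f z - u z| <= 1.
  have /andP[? ?] := u01 z; have /andP[? ?] := f01 z.
  by rewrite ler_norml; apply/andP; split; lra.
have [_ _ _ /(_ _ v1)] := hw.
set c := m (fun x => density _ _ _ * _).
have : m (fun z => (f z - u z) * u z) + 2 * d <= c.
  apply: (@cond_mean_ge _ _ _ _ A0 (fun x => m (fun z => (f z - u z) * Rg mul x f z))).
    by rewrite /Rg; bnd_tac.
  by move=> x /ltW.
rewrite e1 ler_norml => h1 /andP[_ h2] h3; nra.
Qed.

End NearMinimizer.

(** * A pigeonhole principle for means *)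

Section Pigeonhole.
Variables (R : realType) (T : choiceType) (mu : mean R T).

(** Bisection of the range: by subadditivity one of the two halves always keeps positive mean. *)
Lemma mean_pigeonhole_halving (a : T -> R) (n : nat) (C : set T) :
  (forall x, 0 <= a x <= 1) -> 0 < mu (indic R C) ->
  exists C' c, [/\ C' `<=` C, 0 < mu (indic R C') &
    forall x, C' x -> c <= a x <= c + 2^-1 ^+ n].
Proof.
move=> a01 C0; elim: n => [|n [D [c [DC D0 hD]]]].
  by exists C, 0; split => // x _; rewrite expr0 add0r.
pose e : R := 2^-1 ^+ n.+1.
have ee : 2^-1 ^+ n = 2 * e by rewrite /e exprS mulrA divff ?mul1r// pnatr_eq0.
pose D1 := D `&` [set x | a x <= c + e]; pose D2 := D `&` [set x | c + e <= a x].
have : 0 < mu (indic R D1) + mu (indic R D2).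
  apply: (lt_le_trans D0); apply: le_trans (mean_indicU mu D1 D2).
  by apply: le_mean_indic => x Dx; have [h|/ltW h] := leP (a x) (c + e); [left|right].
have [D20|D20 _] := leP (mu (indic R D2)) 0.
  move=> h; exists D1, c; split; first by move=> x [/DC].
    by lra.
  by move=> x [/hD /andP[-> _] /= h']; exact: h'.
exists D2, (c + e); split => //; first by move=> x [/DC].
by move=> x [/hD /andP[_ h]] /= ->; rewrite -addrA -mulr2n -mulr_natl -ee.
Qed.

(** The functions of the list are treated in turn, each one refining the set by bisection until it
    oscillates by at most [e]. *)
Lemma mean_pigeonhole (I : Type) (s : seq I) (a : I -> T -> R) (e : R) :
  (forall i x, 0 <= a i x <= 1) -> 0 < e ->
  exists2 C, 0 < mu (indic R C) & forall x y, C x -> C y ->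
    \sum_(i <- s) (a i x - a i y) ^+ 2 <= (size s)%:R * e ^+ 2.
Proof.
move=> a01 e0; elim: s => [|i s [C C0 hC]].
  exists setT => [|x y _ _]; last by rewrite big_nil mul0r.
  rewrite (eq_mean _ (g := fun=> 1)) ?mean_cst// => x.
  by rewrite indic_in.
pose n := Num.bound e^-1.
have en : 2^-1 ^+ n <= e.
  have : e^-1 < n%:R by apply: archi_boundP; rewrite invr_ge0 ltW.
  have : n%:R <= 2 ^+ n :> R by rewrite -natrX ler_nat ltnW// ltn_expl.
  move=> h1 h2; rewrite exprVn invf_ple ?posrE ?exprn_gt0//.
  by rewrite (le_trans (ltW h2)).
have [D [c [DC D0 hD]]] := mean_pigeonhole_halving n (a01 i) C0.
exists D => // x y Dx Dy.
rewrite big_cons /= -natr1 addrC mulrDl mul1r; apply: lerD.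
  by apply: hC => //; exact: DC.
have /andP[? ?] := hD _ Dx; have /andP[? ?] := hD _ Dy.
by nra.
Qed.

End Pigeonhole.

(** * A length function on the group built from correlations *)

Section LengthFunction.
Variables (R : realType) (G : choiceType).
Variables (mul : G -> G -> G) (one : G) (inv : G -> G).
Hypothesis Hgrp : is_group mul one inv.
Variable m : mean R G.
Hypothesis linv : forall g (p : G -> R), bnd p -> m (fun x => p (mul g x)) = m p.
Hypothesis rinv : forall g (p : G -> R), bnd p -> m (fun x => p (mul x g)) = m p.

Lemma grp_mulA x y z : mul x (mul y z) = mul (mul x y) z.
Proof. by case: Hgrp. Qed.
Lemma grp_mul1 x : mul one x = x.
Proof. by case: Hgrp => _ /(_ x)[]. Qed.
Lemma grp_mulr1 x : mul x one = x.
Proof. by case: Hgrp => _ /(_ x)[]. Qed.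
Lemma grp_mulV x : mul (inv x) x = one.
Proof. by case: Hgrp => _ _ /(_ x)[]. Qed.
Lemma grp_mulrV x : mul x (inv x) = one.
Proof. by case: Hgrp => _ _ /(_ x)[]. Qed.
Lemma grp_mulKV x y : mul x (mul (inv x) y) = y.
Proof. by rewrite grp_mulA grp_mulrV grp_mul1. Qed.
Lemma grp_mulVK x y : mul (inv x) (mul x y) = y.
Proof. by rewrite grp_mulA grp_mulV grp_mul1. Qed.
Lemma grp_inv_uniq x y : mul x y = one -> y = inv x.
Proof. by move=> h; rewrite -(grp_mulVK x y) h grp_mulr1. Qed.
Lemma grp_invM x y : inv (mul x y) = mul (inv y) (inv x).
Proof.
by apply/esym/grp_inv_uniq; rewrite grp_mulA -(grp_mulA x) grp_mulrV grp_mulr1 grp_mulrV.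
Qed.
Lemma grp_invK x : inv (inv x) = x.
Proof. by apply/esym/grp_inv_uniq; rewrite grp_mulV. Qed.
Lemma grp_inv1 : inv one = one.
Proof. by apply/esym/grp_inv_uniq; rewrite grp_mul1. Qed.

Lemma RgM x y (a : G -> R) : Rg mul x (Rg mul y a) = Rg mul (mul x y) a.
Proof. by apply/funext => h; rewrite /Rg grp_mulA. Qed.

Lemma Rg_inner x (a b : G -> R) : bnd a -> bnd b ->
  m (fun z => Rg mul x a z * Rg mul x b z) = m (fun z => a z * b z).
Proof. by move=> ha hb; rewrite /Rg (rinv x (p := fun z => a z * b z))//; bnd_tac. Qed.

Variables f u : G -> R.
Hypothesis f01 : forall x, 0 <= f x <= 1.
Hypothesis u01 : forall x, 0 <= u x <= 1.

Lemma bnd01 (a : G -> R) : (forall x, 0 <= a x <= 1) -> bnd a.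
Proof. by move=> h; exists 1 => x; have /andP[? ?] := h x; rewrite ger0_norm. Qed.

Let bf : bnd f := bnd01 f01.
Let bu : bnd u := bnd01 u01.

Definition corr (z : G) : R := m (fun h => u h * Rg mul z f h).

Lemma corr_itv z : 0 <= corr z <= 1.
Proof.
have hb : bnd (fun h => u h * Rg mul z f h) by rewrite /Rg; bnd_tac.
apply/andP; split; [apply: mean_ge0 => // h|apply: mean_le_cst => // h];
  rewrite /Rg; have /andP[? ?] := u01 h; have /andP[? ?] := f01 (mul h z).
  by rewrite mulr_ge0.
by rewrite mulr_ile1.
Qed.

Lemma bnd_corr : bnd corr. Proof. exact: bnd01 corr_itv. Qed.

(** By right invariance a left translate of [corr] is the correlation of [f] with a translate of
    [u], so [len] measures how far [u] moves as seen by the translates of [f]. *)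
Lemma corrE x z : m (fun h => Rg mul x u h * Rg mul z f h) = corr (mul (inv x) z).
Proof.
rewrite -[in LHS](grp_mulKV x z) -RgM Rg_inner//.
by rewrite /Rg; bnd_tac.
Qed.

(* This is weaker than the norm of [R^x u - u], but all balls have positive mean for it,
   and by [translate_mean_len] it still controls that norm. *)
Definition len (x : G) : R := Num.sqrt (m (fun z => (corr (mul (inv x) z) - corr z) ^+ 2)).

Lemma bnd_len_arg x : bnd (fun z => (corr (mul (inv x) z) - corr z) ^+ 2).
Proof. have := bnd_corr; move=> ?; bnd_tac. Qed.

Lemma len_sqr x : len x ^+ 2 = m (fun z => (corr (mul (inv x) z) - corr z) ^+ 2).
Proof.
by rewrite sqr_sqrtr// mean_ge0 => [//||z]; [exact: bnd_len_arg | exact: sqr_ge0].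
Qed.

Lemma len_ge0 x : 0 <= len x. Proof. exact: sqrtr_ge0. Qed.

Lemma len_le1 x : len x <= 1.
Proof.
rewrite -(@expr_le1 _ 2) ?len_ge0// len_sqr; apply: mean_le_cst; first exact: bnd_len_arg.
move=> z; have /andP[? ?] := corr_itv z; have /andP[? ?] := corr_itv (mul (inv x) z).
by nra.
Qed.

Lemma len_dist x y :
  m (fun z => (corr (mul (inv x) z) - corr (mul (inv y) z)) ^+ 2) = len (mul (inv x) y) ^+ 2.
Proof.
rewrite len_sqr grp_invM grp_invK; have bc := bnd_corr.
rewrite -(linv x) /=; last by bnd_tac.
by apply: eq_mean => z; rewrite grp_mulVK -grp_mulA; ring.
Qed.

Lemma lenV x : len (inv x) = len x.
Proof.
apply/eqP; rewrite -(@eqrXn2 _ 2) ?len_ge0//; apply/eqP.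
have := len_dist x one; rewrite grp_mulr1 => <-; rewrite len_sqr.
by apply: eq_mean => z; rewrite grp_inv1 grp_mul1.
Qed.

(** Minkowski's inequality for the increments [a] and [b] of [corr]; left invariance gives [b] the
    norm [len y]. *)
Lemma lenM x y : len (mul x y) <= len x + len y.
Proof.
rewrite -(@ler_pXn2r _ 2) ?nnegrE ?addr_ge0 ?len_ge0//.
have bc := bnd_corr.
pose a z := corr (mul (inv x) z) - corr z.
pose b z := corr (mul (inv (mul x y)) z) - corr (mul (inv x) z).
have ba : bnd a by rewrite /a; bnd_tac.
have bb : bnd b by rewrite /b; bnd_tac.
have ea : m (fun z => a z ^+ 2) = len x ^+ 2 by rewrite len_sqr.
have eb : m (fun z => b z ^+ 2) = len y ^+ 2.
  by rewrite /b len_dist grp_invM -grp_mulA grp_mulV grp_mulr1 lenV.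
have -> : len (mul x y) ^+ 2 = len x ^+ 2 + 2 * m (fun z => a z * b z) + len y ^+ 2.
  rewrite -ea -eb len_sqr -meanZ -?meanD; [ |bnd_tac..].
  by apply: eq_mean => z; rewrite /a /b; ring.
have := mean_CS m ba bb; rewrite ea eb -exprMn => h.
have := norm_le_of_sqr _ h; rewrite mulr_ge0 ?len_ge0// => /(_ isT).
rewrite ler_norml => /andP[_ h']; rewrite sqrrD; lra.
Qed.

(* The square of [len (x^-1 y)] is a mean over [z] of inner products with the tensor
   squares of [R^z f], which Mazur's theorem on [G * G] replaces by a finite average;
   then the pigeonhole principle applies. *)
Lemma len_ball_gt0 e : 0 < e -> 0 < m (indic R [set x | len x <= e]).
Proof.
move=> e0; have bc := bnd_corr.
pose xi z (p : G * G) := f (mul p.1 z) * f (mul p.2 z).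
have xi1 z p : `|xi z p| <= 1.
  rewrite normrM mulr_ile1// ger0_norm; have /andP[? ?] := f01 (mul p.1 z) => //.
    by have /andP[? ?] := f01 (mul p.2 z).
  by have /andP[? ?] := f01 (mul p.2 z).
(* Mazur costs [e ^+ 2 / 2] and the pigeonhole the square of [e / 2], together less than
   [e ^+ 2]. *)
have d0 : 0 < e ^+ 2 / 2 by rewrite divr_gt0 ?exprn_gt0.
have [s s0 hs] := mean_mazur m (mean_prod m m) xi1 d0.
have e20 : 0 < e / 2 by rewrite divr_gt0.
have [C C0 hC] := mean_pigeonhole m s (a := fun z x => corr (mul (inv x) z))
  (fun z x => corr_itv _) e20.
have [x0 Cx0] := mean_indic_ex C0.
apply: (lt_le_trans C0).
(* Left invariance moves the ball to the centre [x0], where it will contain [C]. *)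
rewrite -[X in _ <= X](linv (inv x0)); last by bnd_tac.
have -> : m (fun x => indic R [set x | len x <= e] (mul (inv x0) x))
   = m (indic R [set x | len (mul (inv x0) x) <= e]) by [].
apply: le_mean_indic => x Cx /=.
rewrite -(@ler_pXn2r _ 2) ?nnegrE ?len_ge0 ?ltW// -len_dist.
pose v0 h := Rg mul x0 u h - Rg mul x u h.
have bv0 : bnd v0 by rewrite /v0 /Rg; bnd_tac.
have v01 h : `|v0 h| <= 1.
  rewrite /v0 /Rg; have /andP[? ?] := u01 (mul h x0); have /andP[? ?] := u01 (mul h x).
  by rewrite ler_norml; apply/andP; split; lra.
have v1 (p : G * G) : `|v0 p.1 * v0 p.2| <= 1 by rewrite normrM mulr_ile1.
(* The square of a mean over [G] is a mean over [G * G], tested against the tensor square of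
   [v0]. *)
have E z : mean_prod m m (fun p => v0 p.1 * v0 p.2 * xi z p) =
    (corr (mul (inv x0) z) - corr (mul (inv x) z)) ^+ 2.
  rewrite -!corrE -meanB; [ |rewrite /Rg; bnd_tac..].
  rewrite expr2 -meanZr /=; last by rewrite /Rg; bnd_tac.
  apply: eq_mean => h; rewrite -meanZ; last by rewrite /Rg; bnd_tac.
  by apply: eq_mean => h'; rewrite /xi /v0 /Rg /=; ring.
have := hs _ v1; rewrite (eq_mean _ (fun z => E z)).
rewrite mean_mul_savg; last by exists 1.
  under eq_bigr do rewrite E.
  have sp : 0 < (size s)%:R :> R by rewrite ltr0n; case: s s0 {hs hC}.
  have : (\sum_(z <- s) (corr (mul (inv x0) z) - corr (mul (inv x) z)) ^+ 2) / (size s)%:R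
     <= (e / 2) ^+ 2.
    by rewrite ler_pdivrMr// mulrC; exact: (hC _ _ Cx0 Cx).
  rewrite ler_norml => h1 /andP[_ h2].
  by rewrite expr_div_n in h1; have := exprn_gt0 2 e0; lra.
by move=> z; exists 1 => p; exact: xi1.
Qed.

(** By invariance the left side is twice the inner product of [u - R^x u] with [u]. Replacing this
    last [u] by the weak integral of translates of [f] costs [2 * d] and leaves the mean of [k]
    times an increment of [corr], to which Cauchy-Schwarz applies. *)
Lemma translate_mean_len d k x : translate_mean mul m f d k u ->
  m (fun z => (Rg mul x u z - u z) ^+ 2)
    <= 2 * (Num.sqrt (m (fun z => k z ^+ 2)) * len x) + 2 * d.
Proof.
move=> [bk k0 k1 hk].
pose v z := u z - Rg mul x u z.
have bRu : bnd (Rg mul x u) by rewrite /Rg; bnd_tac.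
have bv : bnd v by rewrite /v; bnd_tac.
have v1 z : `|v z| <= 1.
  rewrite /v /Rg; have /andP[? ?] := u01 z; have /andP[? ?] := u01 (mul z x).
  by rewrite ler_norml; apply/andP; split; lra.
have bc := bnd_corr.
have -> : m (fun z => (Rg mul x u z - u z) ^+ 2) = 2 * m (fun z => v z * u z).
  have -> : m (fun z => (Rg mul x u z - u z) ^+ 2) =
     m (fun z => Rg mul x u z * Rg mul x u z) + 2 * m (fun z => v z * u z) - m (fun z => u z * u z).
    rewrite -meanZ -?meanD -?meanB; [ |bnd_tac..].
    by apply: eq_mean => z; rewrite /v; ring.
  by rewrite Rg_inner//; ring.
have E z : m (fun h => v h * Rg mul z f h) = corr z - corr (mul (inv x) z).
  rewrite -corrE -meanB; [ |rewrite /Rg; bnd_tac..].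
  by apply: eq_mean => h; rewrite /v; ring.
have := hk _ v1; rewrite (eq_mean _ (g := fun z => k z * (corr z - corr (mul (inv x) z)))); last first.
  by move=> z; rewrite E.
have bd : bnd (fun z => corr z - corr (mul (inv x) z)) by bnd_tac.
have := mean_CS m bk bd.
have -> : m (fun z => (corr z - corr (mul (inv x) z)) ^+ 2) = len x ^+ 2.
  by rewrite len_sqr; apply: eq_mean => z; ring.
set a := m (fun z => k z ^+ 2).
have a0 : 0 <= a by apply: mean_ge0 => [|z]; [bnd_tac|exact: sqr_ge0].
rewrite -{1}(sqr_sqrtr a0) -exprMn => /norm_le_of_sqr.
rewrite mulr_ge0 ?len_ge0 ?sqrtr_ge0// => /(_ isT).
by rewrite !ler_norml => /andP[? ?] /andP[? ?]; lra.
Qed.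

End LengthFunction.

(** * A positive definite kernel supported in a small ball *)

Section BohrKernel.
Variables (R : realType) (G : choiceType).
Variables (mul : G -> G -> G) (one : G) (inv : G -> G).
Hypothesis Hgrp : is_group mul one inv.
Variable m : mean R G.
Hypothesis linv : forall g (p : G -> R), bnd p -> m (fun x => p (mul g x)) = m p.
Hypothesis rinv : forall g (p : G -> R), bnd p -> m (fun x => p (mul x g)) = m p.
Variables (f r : G -> R).
Hypothesis f01 : forall x, 0 <= f x <= 1.
Hypothesis r01 : forall x, 0 <= r x <= 1.
Hypothesis rV : forall x, r (inv x) = r x.
Hypothesis rM : forall x y, r (mul x y) <= r x + r y.
Hypothesis r_ball : forall e, 0 < e -> 0 < m (indic R [set x | r x <= e]).
Variable c : R.
Hypothesis c01 : 0 < c <= 1.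

Let bf : bnd f := bnd01 f01.
Let br : bnd r := bnd01 r01.

Definition bump (z : G) : R := Num.max 0 (c - r z).

Lemma bump_itv z : 0 <= bump z <= 1.
Proof.
have /andP[? ?] := c01; have /andP[? ?] := r01 z.
by rewrite /bump; case: (leP 0 (c - r z)) => ?; apply/andP; split; lra.
Qed.

Let bb : bnd bump := bnd01 bump_itv.

Lemma bump_lip x z : `|bump (mul x z) - bump z| <= r x.
Proof.
have h1 := rM x z; have h2 := rM (inv x) (mul x z).
rewrite (grp_mulVK Hgrp) rV in h2.
by rewrite /bump ler_norml; case: (leP 0 (c - r z)) => ?; case: (leP 0 (c - r (mul x z))) => ?;
  apply/andP; split; have /andP[? ?] := r01 x; lra.
Qed.

Lemma bump_gt0 z : 0 < bump z -> r z < c.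
Proof. by rewrite /bump; case: (leP 0 (c - r z)) => ?; lra. Qed.

(** The autocorrelation of the bump, hence positive definite, and supported in the ball of radius
    [2 * c]. *)
Definition kap (g : G) : R := m (fun z => bump z * bump (mul (inv g) z)).

Lemma kap_itv g : 0 <= kap g <= 1.
Proof.
have hb : bnd (fun z => bump z * bump (mul (inv g) z)) by bnd_tac.
apply/andP; split; [apply: mean_ge0 => // z|apply: mean_le_cst => // z];
  have /andP[? ?] := bump_itv z; have /andP[? ?] := bump_itv (mul (inv g) z).
  by rewrite mulr_ge0.
by rewrite mulr_ile1.
Qed.

Let bk : bnd kap := bnd01 kap_itv.

Lemma kapE h g : kap (mul (inv h) g) = m (fun z => bump (mul (inv h) z) * bump (mul (inv g) z)).
Proof.
rewrite /kap -(linv (inv h)); last by bnd_tac.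
by apply: eq_mean => z; rewrite (grp_invM Hgrp) (grp_invK Hgrp) -(grp_mulA Hgrp) (grp_mulKV Hgrp).
Qed.

Lemma kap_sym h g : kap (mul (inv h) g) = kap (mul (inv g) h).
Proof. by rewrite !kapE; apply: eq_mean => z; rewrite mulrC. Qed.

Lemma kap_lip x y : `|kap (mul x y) - kap y| <= r x.
Proof.
have -> : kap (mul x y) = m (fun z => bump (mul x z) * bump (mul (inv y) z)).
  rewrite -[in LHS](grp_invK Hgrp x) kapE (grp_invK Hgrp).
  by [].
rewrite /kap -meanB; [ |bnd_tac..].
apply: norm_mean_le => z; rewrite -mulrBl normrM -[X in _ <= X]mulr1.
apply: ler_pM => //; first exact: bump_lip.
by have /andP[? ?] := bump_itv (mul (inv y) z); rewrite ger0_norm.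
Qed.

Lemma kap_supp g : ~ (r g <= 2 * c) -> kap g = 0.
Proof.
move=> rg; rewrite -[RHS](mean_cst m); apply: eq_mean => z.
have /andP[z0 _] := bump_itv z; have /andP[g0 _] := bump_itv (mul (inv g) z).
have [->|nz] := eqVneq (bump z) 0; first by rewrite mul0r.
have [->|ng] := eqVneq (bump (mul (inv g) z)) 0; first by rewrite mulr0.
have h1 : r z < c by apply: bump_gt0; rewrite lt_neqAle eq_sym nz.
have h2 : r (mul (inv g) z) < c by apply: bump_gt0; rewrite lt_neqAle eq_sym ng.
exfalso; apply: rg; rewrite -(rV g); have := rM (mul (inv g) z) (inv z).
by rewrite -(grp_mulA Hgrp) (grp_mulrV Hgrp) (grp_mulr1 Hgrp) !rV; lra.
Qed.

(** When [g] and [z] have length at most [c / 4], both bumps are at least [c / 2]; such elements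
    have positive mean by [r_ball]. *)
Lemma mean_kap_gt0 : 0 < m kap.
Proof.
have /andP[c0 c1] := c01.
pose B := [set x | r x <= c / 4].
have B0 : 0 < m (indic R B) by apply: r_ball; rewrite divr_gt0.
apply: (@lt_le_trans _ _ ((c / 2) ^+ 2 * m (indic R B) * m (indic R B))).
  by do 2?[apply: mulr_gt0 => //]; rewrite exprn_gt0// divr_gt0.
rewrite -meanZ; last by bnd_tac.
apply: le_mean => [||g]; [bnd_tac..|].
have [Bg|Bg] := pselect (B g); last first.
  by rewrite (indic_notin R Bg) mulr0; have /andP[] := kap_itv g.
rewrite (indic_in R Bg) mulr1 /kap -meanZ; last by bnd_tac.
apply: le_mean => [||z]; [bnd_tac..|].
have /andP[z0 _] := bump_itv z; have /andP[g0 _] := bump_itv (mul (inv g) z).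
have [Bz|Bz] := pselect (B z); last by rewrite (indic_notin R Bz) mulr0 mulr_ge0.
rewrite (indic_in R Bz) mulr1 expr2.
have hg : r g <= c / 4 := Bg; have h2 : r z <= c / 4 := Bz.
have h1 : r (mul (inv g) z) <= c / 2 by have := rM (inv g) z; rewrite rV; lra.
apply: ler_pM; rewrite ?divr_ge0 ?(ltW c0)//; rewrite /bump le_max; apply/orP; right; lra.
Qed.

Definition kap_density g := kap g / m kap.

Lemma kap_density_mean :
  [/\ bnd kap_density, forall g, 0 <= kap_density g & m kap_density = 1].
Proof.
split; first by rewrite /kap_density; bnd_tac.
  by move=> g; rewrite divr_ge0 ?(ltW mean_kap_gt0)//; have /andP[] := kap_itv g.
by rewrite /kap_density meanZr// divff// gt_eqF// mean_kap_gt0.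
Qed.

Definition bohr_mean : mean R G :=
  let: And3 h1 h2 h3 := kap_density_mean in weighted_mean h1 h2 h3.

Lemma bohr_meanE (g : G -> R) : bohr_mean g = m (fun x => kap_density x * g x).
Proof. by rewrite /bohr_mean; case: kap_density_mean. Qed.

Lemma bohr_mean_supp : bohr_mean (indic R [set g | ~ (r g <= 2 * c)]) = 0.
Proof.
rewrite bohr_meanE -[RHS](mean_cst m); apply: eq_mean => g.
have [h|h] := pselect (r g <= 2 * c); first by rewrite indic_notin ?mulr0//= => /(_ h).
by rewrite /kap_density (kap_supp h) !mul0r.
Qed.

Lemma bohr_mean_null A : m (indic R A) = 0 -> bohr_mean (indic R A) = 0.
Proof.
move=> A0; apply/eqP; rewrite eq_le mean_indic_ge0 andbT bohr_meanE.
have [bd _ _] := kap_density_mean.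
rewrite -(mul0r (m kap)^-1) -A0 -meanZr; last by bnd_tac.
apply: le_mean => [||g]; [bnd_tac..|].
rewrite mulrAC ler_pM2r ?invr_gt0 ?mean_kap_gt0//.
by rewrite ler_piMl ?indic_ge0//; have /andP[] := kap_itv g.
Qed.

(** Up to the factor [m kap], this is the [bohr_mean] of [f (mul h g)] in [g], after a left
    translation by [h]. *)
Let conv h := m (fun g => kap (mul (inv h) g) * f g).

(* [kap (h^-1 g)] is an inner product of translates of the bump, so it is a positive
   kernel whose marginals are constant; apply this to [f - m f]. *)
Lemma conv_inner_ge : m f ^+ 2 * m kap <= m (fun h => f h * conv h).
Proof.
set d := m f; set k := m kap.
have bk2 : bnd (fun p : G * G => kap (mul (inv p.1) p.2)) by bnd_tac.
have bconv : bnd conv by rewrite /conv; bnd_tac.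
have mconv : m conv = d * k.
  rewrite /conv.
  transitivity (m (fun h => m (fun g => m (fun z =>
     bump (mul (inv h) z) * (bump (mul (inv g) z) * f g))))).
    apply: eq_mean => h; apply: eq_mean => g; rewrite kapE -meanZr; last by bnd_tac.
    by apply: eq_mean => z; rewrite mulrA.
  (* The means over [h] and [g] may be exchanged because the kernel is an inner product over [z]. *)
  rewrite (@mean_swap R G G G m m m (fun h z => bump (mul (inv h) z))
    (fun g z => bump (mul (inv g) z) * f g)); first last.
  - move=> g z; rewrite normrM mulr_ile1// ger0_norm; have /andP[? ?] := bump_itv (mul (inv g) z);
      have /andP[? ?] := f01 g => //.
  - by move=> h z; rewrite ger0_norm; have /andP[] := bump_itv (mul (inv h) z).
  transitivity (m (fun g => f g * m (fun h => kap (mul (inv g) h)))).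
    apply: eq_mean => g; rewrite -meanZ; last by bnd_tac.
    apply: eq_mean => h; rewrite -kap_sym kapE -meanZ; last by bnd_tac.
    by apply: eq_mean => z; ring.
  by rewrite -/d /k /d -meanZr//; apply: eq_mean => g; rewrite linv.
have := @mean2_ge0 R G G m m (fun h z => (f h - d) * bump (mul (inv h) z)).
have h : bnd (fun p : G * G => (f p.1 - d) * bump (mul (inv p.1) p.2)) by bnd_tac.
move=> /(_ h).
have -> : m (fun x => m (fun y => m (fun z =>
    (f x - d) * bump (mul (inv x) z) * ((f y - d) * bump (mul (inv y) z))))) =
   m (fun h => f h * conv h) - d * m conv.
  transitivity (m (fun h => f h * conv h - d * k * f h - d * conv h + d ^+ 2 * k)).
    apply: eq_mean => x.
    transitivity (m (fun y => f x * (kap (mul (inv x) y) * f y) - d * f x * kap (mul (inv x) y)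
       - d * (kap (mul (inv x) y) * f y) + d ^+ 2 * kap (mul (inv x) y))).
      apply: eq_mean => y; rewrite kapE.
      transitivity ((f x - d) * (f y - d) * m (fun z => bump (mul (inv x) z) * bump (mul (inv y) z))).
        by rewrite -meanZ; [apply: eq_mean => z; ring | bnd_tac].
      by ring.
    rewrite meanD ?meanB ?meanZ; [ |bnd_tac..].
    by rewrite linv// /conv /k; ring.
  rewrite meanD ?meanB ?meanZ ?mean_cst; [ |bnd_tac..].
  by rewrite mconv -/d; ring.
by rewrite mconv subr_ge0 mulrA -expr2.
Qed.

(** A right translation by [inv x] moves [x] from [f] into [conv]. By [kap_lip] this changes [conv]
    by at most [r x], and [conv_inner_ge] does the rest. *)
Lemma bohr_mean_inner e x : r x <= e * m kap ->
  m f ^+ 2 - e <= m (fun h => f (mul h x) * bohr_mean (fun g => f (mul h g))).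
Proof.
move=> hx; have k0 := mean_kap_gt0.
have bk2 : bnd (fun p : G * G => kap (mul (inv p.1) p.2)) by bnd_tac.
have bconv : bnd conv by rewrite /conv; bnd_tac.
have E h : bohr_mean (fun g => f (mul h g)) = conv h / m kap.
  rewrite bohr_meanE /conv -meanZr; last by bnd_tac.
  rewrite -(linv h (p := fun g => kap (mul (inv h) g) * f g / m kap)); last by bnd_tac.
  by apply: eq_mean => g; rewrite (grp_mulVK Hgrp) /kap_density; ring.
have -> : m (fun h => f (mul h x) * bohr_mean (fun g => f (mul h g)))
    = m (fun h => f (mul h x) * conv h / m kap).
  by apply: eq_mean => h; rewrite E mulrA.
rewrite meanZr; last by bnd_tac.
rewrite ler_pdivlMr// mulrBl.
rewrite -(rinv (inv x) (p := fun h => f (mul h x) * conv h)); last by bnd_tac.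
have -> : m (fun h => f (mul (mul h (inv x)) x) * conv (mul h (inv x)))
    = m (fun h => f h * conv (mul h (inv x))).
  by apply: eq_mean => h; rewrite -(grp_mulA Hgrp) (grp_mulV Hgrp) (grp_mulr1 Hgrp).
apply: (@le_trans _ _ (m (fun h => f h * conv h) - r x)).
  by apply: lerB => //; exact: conv_inner_ge.
rewrite -(mean_cst m (r x)) -meanB; [ |bnd_tac..].
apply: le_mean => [||h]; [bnd_tac..|].
have : `|conv (mul h (inv x)) - conv h| <= r x.
  rewrite /conv -meanB; [ |bnd_tac..].
  apply: norm_mean_le => g; rewrite -mulrBl normrM -[X in _ <= X]mulr1.
  rewrite (grp_invM Hgrp) (grp_invK Hgrp) -(grp_mulA Hgrp).
  apply: ler_pM => //; first exact: kap_lip.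
  by have /andP[? ?] := f01 g; rewrite ger0_norm.
have /andP[? ?] := f01 h; have /andP[? ?] := r01 x.
rewrite ler_norml => /andP[h1 h2]; nra.
Qed.

End BohrKernel.

(** * Null sets of a mean *)

Section NullSets.
Variables (R : realType) (T : choiceType) (mu : mean R T).

Lemma mean_mul_null (k : T -> R) A : bnd k -> mu (indic R A) = 0 ->
  mu (fun x => k x * indic R A x) = 0.
Proof.
move=> bk A0; have bA := bnd_indic R A.
have := mean_CS mu bk bA.
rewrite (_ : mu (fun z => indic R A z ^+ 2) = 0) ?mulr0; last first.
  rewrite -A0; apply: eq_mean => z; rewrite /indic; case: ifP; rewrite ?expr1n ?expr0n//.
by move=> h; apply/eqP; rewrite -sqrf_eq0 eq_le h sqr_ge0.
Qed.

Lemma mean_le_off_null (g : T -> R) A c : bnd g -> mu (indic R A) = 0 ->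
  (forall x, ~ A x -> g x <= c) -> mu g <= c.
Proof.
move=> bg A0 h; have bA := bnd_indic R A.
have bgc : bnd (fun x => g x - c) by bnd_tac.
have := mean_mul_null bgc A0 => e0.
have : 0 <= mu (fun x => c - g x + (g x - c) * indic R A x).
  apply: mean_ge0 => [|x]; first by bnd_tac.
  have [Ax|Ax] := pselect (A x); first by rewrite indic_in// mulr1 addrA subrK subrr.
  by rewrite indic_notin// mulr0 addr0 subr_ge0 h.
rewrite meanD ?meanB ?mean_cst ?e0 ?addr0 ?subr_ge0//; bnd_tac.
Qed.

Lemma mean_indicU_null A B : mu (indic R A) = 0 -> mu (indic R B) = 0 ->
  mu (indic R (A `|` B)) = 0.
Proof.
move=> A0 B0; apply/eqP; rewrite eq_le mean_indic_ge0 andbT.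
by rewrite (le_trans (mean_indicU mu A B))// A0 B0 addr0.
Qed.

Lemma le_mean_indic_null A B : A `<=` B -> mu (indic R B) = 0 -> mu (indic R A) = 0.
Proof.
by move=> AB B0; apply/eqP; rewrite eq_le mean_indic_ge0 andbT -B0 le_mean_indic.
Qed.

End NullSets.

(** * Recurrence along a Bohr neighbourhood *)

Section Recurrence.
Variables (R : realType) (G : choiceType).
Variables (mul : G -> G -> G) (one : G) (inv : G -> G).
Hypothesis Hgrp : is_group mul one inv.
Variable m : mean R G.
Hypothesis linv : forall g (p : G -> R), bnd p -> m (fun x => p (mul g x)) = m p.
Hypothesis rinv : forall g (p : G -> R), bnd p -> m (fun x => p (mul x g)) = m p.
Variable f : G -> R.
Hypothesis f01 : forall x, 0 <= f x <= 1.

Let bf : bnd f := bnd01 f01.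

(** Split the inner product as in [e3]. Its first term is that of [f - u] with the translate of [f]
    by [mul (inv x) y], controlled by [near_minimizer_null] off a left translate of a null set.
    Replacing [R^x u] by [u] costs [t] twice. *)
Lemma translate_corr_null d t u x : 0 < d <= 1 -> 0 <= t ->
  admissible mul m f d u ->
  (forall w, admissible mul m f d w ->
    m (fun z => (f z - u z) ^+ 2) <= m (fun z => (f z - w z) ^+ 2) + d ^+ 2 / 2) ->
  m (fun z => (Rg mul x u z - u z) ^+ 2) <= t ^+ 2 ->
  m (indic R [set y | 2 * t + 2 * d
    < m (fun z => (Rg mul x f z - u z) * (Rg mul y f z - u z))]) = 0.
Proof.
move=> d01 t0 au umin ht; have [u01 _] := au.
have bu : bnd u := bnd01 u01.
have null := near_minimizer_null f01 d01 au umin.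
set A := [set y | _] in null.
rewrite -(linv (inv x)) in null; last by bnd_tac.
apply: le_mean_indic_null null => y /=; rewrite /A /= => hy.
have bRf z : bnd (Rg mul z f) by rewrite /Rg; bnd_tac.
have bRu z : bnd (Rg mul z u) by rewrite /Rg; bnd_tac.
have CSt z : `|m (fun h => (Rg mul x u h - u h) * Rg mul z f h)| <= t.
  apply: norm_le_of_sqr => //; have bd : bnd (fun h => Rg mul x u h - u h) by bnd_tac.
  apply: (le_trans (mean_CS m bd (bRf z))); rewrite -[X in _ <= X]mulr1.
  apply: ler_pM => //.
  - by apply: mean_ge0 => [|h]; [bnd_tac|exact: sqr_ge0].
  - by apply: mean_ge0 => [|h]; [bnd_tac|exact: sqr_ge0].
  - apply: mean_le_cst => [|h]; first by bnd_tac.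
    by rewrite /Rg; have /andP[? ?] := f01 (mul h z); rewrite expr_le1.
have := CSt x; have := CSt y; rewrite !ler_norml => /andP[_ h1] /andP[_ h2].
have e1 : m (fun z => (f z - u z) * Rg mul (mul (inv x) y) f z)
    = m (fun z => (Rg mul x f z - Rg mul x u z) * Rg mul y f z).
  have bfu : bnd (fun z => f z - u z) by bnd_tac.
  rewrite -(Rg_inner rinv x bfu (bRf _)) (RgM Hgrp) (grp_mulKV Hgrp).
  by apply: eq_mean => z.
have e2 : m (fun h => (Rg mul x u h - u h) * Rg mul x f h)
   = m (fun h => u h * f h) - m (fun h => u h * Rg mul x f h).
  rewrite -(Rg_inner rinv x bu bf) -meanB; [ |bnd_tac..].
  by apply: eq_mean => h; ring.
have e3 : m (fun z => (Rg mul x f z - u z) * (Rg mul y f z - u z)) =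
   m (fun z => (Rg mul x f z - Rg mul x u z) * Rg mul y f z)
   + m (fun h => (Rg mul x u h - u h) * Rg mul y f h)
   - m (fun h => u h * Rg mul x f h) + m (fun h => u h * u h).
  rewrite -meanD -?meanB -?meanD; [ |bnd_tac..].
  by apply: eq_mean => h; ring.
have e4 : m (fun z => (f z - u z) * u z) = m (fun h => u h * f h) - m (fun h => u h * u h).
  by rewrite -meanB; [apply: eq_mean => h; ring|bnd_tac..].
rewrite e1 e4; rewrite e3 in hy; rewrite e2 in h2; lra.
Qed.

(* [u] plays the role of the projection of [f] to its compact part and [Q] that of a
   measure concentrated on a Bohr neighbourhood of the identity. *)
Lemma bohr_recurrence e : 0 < e <= 1 -> exists (u : G -> R) (Q : mean R G) (B : set G),
  [/\ forall x, 0 <= u x <= 1,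
      forall A, m (indic R A) = 0 -> Q (indic R A) = 0,
      Q (indic R (~` B)) = 0,
      forall x, B x -> m (indic R [set y | e
        < m (fun z => (Rg mul x f z - u z) * (Rg mul y f z - u z))]) = 0 &
      m f ^+ 2 - e <= m (fun h => u h * Q (fun g => f (mul h g)))].
Proof.
move=> /andP[e0 e1].
(* Then [2 * t + 2 * d <= e ^+ 2 / 4], whose square root [e / 2] is lost in [CS] below, and [2 * d]
   uses only half of [t ^+ 2] in [translate_mean_len]. *)
pose t := e ^+ 2 / 16; pose d := t ^+ 2 / 4.
have t0 : 0 < t by rewrite divr_gt0 ?exprn_gt0.
have e2 : e ^+ 2 <= 1 by rewrite expr_le1// ltW.
have t1 : t <= 1 by rewrite /t; lra.
have d0 : 0 < d by rewrite divr_gt0 ?exprn_gt0.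
have t2 : t ^+ 2 <= t by rewrite expr2 ler_piMl// ltW.
have d1 : d <= t by rewrite /d; lra.
have d01 : 0 < d <= 1 by rewrite d0; lra.
have [u au umin] := near_minimizer mul m f01 d0.
have [u01 [k hk]] := au.
have bu : bnd u := bnd01 u01.
pose K := Num.sqrt (m (fun z => k z ^+ 2)).
have K0 : 0 <= K by exact: sqrtr_ge0.
pose r := len mul inv m f u.
have r01 x : 0 <= r x <= 1 by rewrite /r len_ge0 (len_le1 _ _ _ f01 u01).
have rV x : r (inv x) = r x := lenV Hgrp linv f01 u01 x.
have rM x y : r (mul x y) <= r x + r y := lenM Hgrp linv f01 u01 x y.
have rball s : 0 < s -> 0 < m (indic R [set x | r x <= s]) :=
  len_ball_gt0 Hgrp linv rinv f01 u01 (e := s).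
(* On the ball of radius [2 * c] the length term of [translate_mean_len] is at most the other half
   of [t ^+ 2]; the [+ 1] keeps the denominator positive. *)
pose c := t ^+ 2 / (8 * (K + 1)).
have c0 : 0 < c by rewrite divr_gt0 ?exprn_gt0// mulr_gt0// ltr_wpDl.
have cK : 8 * c * (K + 1) = t ^+ 2 by rewrite /c; field; rewrite gt_eqF// ltr_wpDl.
have c01 : 0 < c <= 1.
  rewrite c0 /=; have : c * K >= 0 by rewrite mulr_ge0// ltW.
  by nra.
have hN x : r x <= 2 * c -> m (indic R [set y | e ^+ 2 / 4
    < m (fun z => (Rg mul x f z - u z) * (Rg mul y f z - u z))]) = 0.
  move=> hx; have : m (fun z => (Rg mul x u z - u z) ^+ 2) <= t ^+ 2.
    apply: (le_trans (translate_mean_len Hgrp rinv f01 u01 x hk)).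
    rewrite -/K -/(r x); have : K * r x <= K * (2 * c) by rewrite ler_wpM2l.
    have : 2 * d = t ^+ 2 / 2 by rewrite /d; field.
    by move=> -> h; nra.
  move=> /(translate_corr_null d01 (ltW t0) au umin).
  apply: le_mean_indic_null => y /=; apply: le_lt_trans.
  by have : 4 * t = e ^+ 2 / 4 by [rewrite /t; field]; lra.
pose Q := bohr_mean r01 rV rM rball c01.
pose B := [set x | r x <= 2 * c].
exists u, Q, B; split => //.
- by move=> A A0; apply: bohr_mean_null.
- exact: (bohr_mean_supp Hgrp).
- move=> x /hN; apply: le_mean_indic_null => y /=; apply: le_lt_trans.
  by have : e ^+ 2 <= e by [rewrite expr2 ler_piMl// ltW]; lra.
pose kp := m (kap mul inv m r c).
have kp0 : 0 < kp := mean_kap_gt0 r01 rV rM rball c01.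
(* Small enough both for [hN] and for [bohr_mean_inner] with loss [e / 2]. *)
pose eta := Num.min (2 * c) (e / 2 * kp).
have eta0 : 0 < eta by rewrite lt_min; apply/andP; split; rewrite mulr_gt0// divr_gt0.
pose C := [set x | r x <= eta].
have C0 : 0 < m (indic R C) := rball _ eta0.
have CP x : C x -> r x <= 2 * c /\ r x <= e / 2 * kp.
  by rewrite /C /= le_min => /andP.
pose P := cond_mean C0.
have bd := bnd_density m C.
pose F h := Q (fun g => f (mul h g)).
have F01 h : 0 <= F h <= 1.
  apply/andP; split; [apply: mean_ge0|apply: mean_le_cst]; try by bnd_tac.
    by move=> g; have /andP[] := f01 (mul h g).
  by move=> g; have /andP[] := f01 (mul h g).
have bF : bnd F := bnd01 F01.
have bxi : bnd (fun p : G * G => Rg mul p.1 f p.2 - u p.2) by rewrite /Rg; bnd_tac.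
have bRf z : bnd (Rg mul z f) by rewrite /Rg; bnd_tac.
(* Averaged over [C] and tested against [F], the translates of [f] differ from [u] by at most
   [e / 2]; this turns the bound of [bohr_mean_inner] into one for [u]. *)
have CS : `|P (fun x => m (fun z => F z * (Rg mul x f z - u z)))| <= e / 2.
  apply: norm_le_of_sqr; first by rewrite divr_ge0// ltW.
  apply: (le_trans (mean_CS2 P m bxi bF)).
  rewrite -[X in _ <= X]mul1r; apply: ler_pM.
  - by apply: mean_ge0 => [|z]; [bnd_tac|exact: sqr_ge0].
  - exact: mean2_ge0 bxi.
  - apply: mean_le_cst => [|z]; first by bnd_tac.
    by have /andP[? ?] := F01 z; rewrite expr_le1.
  apply: cond_mean_le; first by rewrite /Rg; bnd_tac.
  move=> x /CP[/hN hx _]; rewrite (_ : (e / 2) ^+ 2 = e ^+ 2 / 4); last by field.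
  have PN : P (indic R [set y | e ^+ 2 / 4
      < m (fun z => (Rg mul x f z - u z) * (Rg mul y f z - u z))]) = 0 := mean_mul_null bd hx.
  apply: (mean_le_off_null _ PN); first by rewrite /Rg; bnd_tac.
  by move=> y /= /negP; rewrite -leNgt.
have : m f ^+ 2 - e / 2 <= P (fun x => m (fun z => Rg mul x f z * F z)).
  apply: cond_mean_ge; first by rewrite /Rg; bnd_tac.
  by move=> x /CP[_ hx]; exact: (bohr_mean_inner Hgrp linv rinv f01).
have E : P (fun x => m (fun z => F z * (Rg mul x f z - u z))) =
    P (fun x => m (fun z => Rg mul x f z * F z)) - m (fun z => u z * F z).
  rewrite -[X in _ = _ - X](mean_cst P) -meanB; [ |rewrite /Rg; bnd_tac..].
  apply: eq_mean => x; rewrite -meanB; [ |bnd_tac..].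
  by apply: eq_mean => z; ring.
move: CS; rewrite E ler_norml => /andP[_ h1] h2; lra.
Qed.

End Recurrence.

(** * Limits along ultrafilters *)

Section UltrafilterMean.
Variables (R : realType) (T : choiceType) (U : set (set T)).
Hypothesis HU : is_ultrafilter U.

Lemma ultraT : U setT. Proof. by case: HU. Qed.

Lemma ultra0 : ~ U set0. Proof. by case: HU. Qed.

Lemma ultraI A B : U A -> U B -> U (A `&` B). Proof. by case: HU => _ _ h _ _; exact: h. Qed.

Lemma ultraS A B : A `<=` B -> U A -> U B. Proof. by case: HU => _ _ _ h _; exact: h. Qed.

Lemma ultraC A : ~ U A -> U (~` A). Proof. by case: HU => _ _ _ _ /(_ A)[]. Qed.

Lemma ultra_ex A : U A -> exists x, A x.
Proof. by move=> UA; apply/set0P/eqP => A0; apply: ultra0; rewrite -A0. Qed.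

Lemma is_ulim_unique (g : T -> R) l l' : is_ulim U g l -> is_ulim U g l' -> l = l'.
Proof.
move=> h h'; apply/eqP; rewrite -subr_eq0 -normr_le0; apply/ler_addgt0Pl => e e0.
rewrite addr0; have e20 : 0 < e / 2 by rewrite divr_gt0.
have [x [/= h1 h2]] := ultra_ex (ultraI (h _ e20) (h' _ e20)).
move: h1 h2; rewrite !ltr_norml ler_norml => /andP[? ?] /andP[? ?].
by apply/andP; split; lra.
Qed.

(** The limit is the supremum of the levels that [g] reaches on a member of [U]. *)
Lemma is_ulim_ex (g : T -> R) : bnd g -> exists l, is_ulim U g l.
Proof.
move=> [C hC]; pose S : set R := [set t | U [set x | t <= g x]].
have SC : S (- C).
  by apply: ultraS ultraT => x _ /=; have := hC x; rewrite ler_norml => /andP[].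
have Sub : ubound S C.
  move=> t /ultra_ex[x /= h]; apply: (le_trans h).
  by have := hC x; rewrite ler_norml => /andP[].
have hS : has_sup S by split; [exists (- C) | exists C].
exists (sup S) => e e0.
have [t St ht] := sup_adherent e0 hS.
have nS : ~ S (sup S + e / 2).
  by move=> h; have := sup_upper_bound hS h; have := e0; lra.
apply: ultraS (ultraI St (ultraC nS)) => x /= [h1 /negP]; rewrite -ltNge => h2.
by rewrite ltr_norml; apply/andP; split; lra.
Qed.

Lemma ulimP (g : T -> R) : bnd g -> is_ulim U g (ulim U g).
Proof. by move=> /is_ulim_ex h; exact: (@xgetPex _ 0 [set l | is_ulim U g l] h). Qed.

Lemma is_ulimE (g : T -> R) l : is_ulim U g l -> ulim U g = l.
Proof.
move=> hl; apply: is_ulim_unique (hl).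
exact: (@xgetPex _ 0 [set l | is_ulim U g l] (ex_intro _ l hl)).
Qed.

Lemma ulimD (g h : T -> R) : bnd g -> bnd h ->
  ulim U (fun x => g x + h x) = ulim U g + ulim U h.
Proof.
move=> /ulimP hg /ulimP hh; apply: is_ulimE => e e0.
have e20 : 0 < e / 2 by rewrite divr_gt0.
apply: ultraS (ultraI (hg _ e20) (hh _ e20)) => x /= [].
by rewrite !ltr_norml => /andP[? ?] /andP[? ?]; apply/andP; split; lra.
Qed.

Lemma ulimZ c (g : T -> R) : bnd g -> ulim U (fun x => c * g x) = c * ulim U g.
Proof.
move=> /ulimP hg; apply: is_ulimE => e e0.
have c0 : 0 < `|c| + 1 by rewrite ltr_wpDl.
apply: ultraS (hg _ (divr_gt0 e0 c0)) => x /=.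
rewrite ltr_pdivlMr// -mulrBr normrM => h.
by have := normr_ge0 (g x - ulim U g); nra.
Qed.

Lemma ulim_ge (g : T -> R) c : bnd g -> U [set x | c <= g x] -> c <= ulim U g.
Proof.
move=> /ulimP hg Uc; apply/ler_addgt0Pl => e e0.
have [x [/= h1]] := ultra_ex (ultraI Uc (hg _ e0)).
by rewrite ltr_norml => /andP[? ?]; lra.
Qed.

Lemma ulim_cst (c : R) : ulim U (fun _ => c) = c.
Proof. by apply: is_ulimE => e e0; apply: ultraS ultraT => x _ /=; rewrite subrr normr0. Qed.

Definition umean : mean R T.
Proof.
refine (@Mean R T (@ulim T R U) ulimD ulimZ _ (ulim_cst 1)).
by move=> g bg g0; apply: ulim_ge => //; apply: ultraS ultraT => x _ /=.
Defined.

Lemma umean_gt0_ex (g : T -> R) A : bnd g -> 0 < umean g -> U A -> exists2 x, A x & 0 < g x.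
Proof.
move=> /ulimP hg g0 UA.
have [x [/= Ax]] := ultra_ex (ultraI UA (hg _ g0)).
by rewrite ltr_norml => /andP[h _]; exists x => //=; move: g0 h => /=; lra.
Qed.

Lemma umean_indic_null A : U A -> umean (indic R (~` A)) = 0.
Proof.
move=> UA; apply: is_ulimE => e e0; apply: ultraS UA => x Ax /=.
by rewrite indic_notin ?subrr ?normr0//= => /(_ Ax).
Qed.

End UltrafilterMean.

Lemma is_ultrafilter_ex (T : choiceType) (F : set_system T) : ProperFilter F ->
  exists U : set (set T), is_ultrafilter U /\ F `<=` U.
Proof.
move=> FF; have [U [UU FU]] := ultraFilterLemma FF.
exists U; split=> //; split.
- exact: filterT.
- exact: filter_not_empty.
- by move=> A B; exact: filterI.
- by move=> A B; exact: filterS.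
- by move=> A; exact: in_ultra_setVsetC.
Qed.

(** * Subsequences and intersectivity from an ultrafilter on the naturals *)

Section NaturalUltrafilter.
Variables (R : realType) (q : set (set nat)).
Hypothesis Hq : is_ultrafilter q.
Hypothesis q_oo : \oo `<=` q.

Lemma ultra_infinite A n : q A -> exists2 k, (n < k)%N & A k.
Proof.
move=> qA; have hn : q [set k | (n < k)%N] by apply: q_oo; exists n.+1.
by have [k [Ak nk]] := ultra_ex Hq (ultraI Hq qA hn); exists k.
Qed.

Lemma cvg_ulim (x : nat -> R) (l : R) : x @ \oo --> l -> ulim q x = l.
Proof.
move=> /cvgrPdist_lt h; apply: (is_ulimE Hq) => e e0; apply: q_oo.
by have := h e e0; apply: filterS => n /=; rewrite distrC.
Qed.

Lemma increasing_ge (s : nat -> nat) :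
  (forall n k, (n < k)%N -> (s n < s k)%N) -> forall n, (n <= s n)%N.
Proof. by move=> h; elim=> // n IH; apply: leq_ltn_trans IH (h _ _ _). Qed.

Lemma cvg_increasing (x : nat -> R) (l : R) (s : nat -> nat) :
  (forall n k, (n < k)%N -> (s n < s k)%N) -> x @ \oo --> l -> x \o s @ \oo --> l.
Proof.
move=> hs /cvgrPdist_lt h; apply/cvgrPdist_lt => e e0.
have [N _ hN] := h e e0; exists N => // n /= Nn.
by apply: hN => /=; apply: leq_trans Nn (increasing_ge hs n).
Qed.

(** Induction on the bound for the codes: each step adds at most one index, hence one intersection
    in [q]. *)
Lemma ultra_near_finitely_many (I : countType) (x : I -> nat -> R) e n :
  (forall i, bnd (x i)) -> 0 < e ->
  q [set k | forall i, (choice.pickle i < n)%N -> `|x i k - ulim q (x i)| < e].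
Proof.
move=> bx e0; elim: n => [|n IH].
  by apply: (ultraS Hq) (ultraT Hq) => k _ i.
have [[j jn]|/forallNP nj] := pselect (exists j : I, choice.pickle j = n).
  apply: (ultraS Hq) (ultraI Hq IH (ulimP Hq (bx j) e0)) => k /= [h1 h2] i.
  rewrite ltnS leq_eqVlt => /orP[/eqP|]; last exact: h1.
  by rewrite -jn => /(pcan_inj choice.pickleK) ->.
apply: (ultraS Hq) IH => k h i; rewrite ltnS leq_eqVlt => /orP[/eqP /nj //|]; exact: h.
Qed.

(** At stage [n] choose an index beyond the previous one at which the sequences of code below [n]
    are within [1 / n.+1] of their limits. Such indices form a member of [q], hence an infinite
    set. *)
Lemma diagonal_subsequence (I : countType) (x : I -> nat -> R) : (forall i, bnd (x i)) ->
  exists2 s : nat -> nat, forall n k, (n < k)%N -> (s n < s k)%N &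
    forall i, x i \o s @ \oo --> ulim q (x i).
Proof.
move=> bx.
have step (p : nat * nat) : exists k, (p.2 < k)%N /\
    forall i, (choice.pickle i < p.1)%N -> `|x i k - ulim q (x i)| < (p.1.+1%:R)^-1.
  have e0 : 0 < (p.1.+1%:R)^-1 :> R by rewrite invr_gt0 ltr0n.
  by have [k h1 h2] := ultra_infinite p.2 (ultra_near_finitely_many p.1 bx e0); exists k.
have [F hF] := choice step.
pose s := fix s n := if n is n'.+1 then F (n, s n') else F (0, 0)%N.
have s1 n : (s n < s n.+1)%N by have [] := hF (n.+1, s n).
exists s => [n k|i]; first exact: (homo_ltn ltn_trans s1).
apply/cvgrPdist_lt => e e0.
pose n0 := maxn (choice.pickle i).+1 (Num.bound e^-1).
exists n0 => // n /= hn.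
have [n' en] : exists n', n = n'.+1.
  by exists n.-1; rewrite prednK// (leq_trans _ hn)// leq_max.
rewrite distrC en /=; have [_ /(_ i)] := hF (n, s n'); rewrite -en => h.
apply: (lt_trans (h _)); first by rewrite /= (leq_trans _ hn)// leq_max leqnn.
rewrite /= invf_plt ?posrE ?ltr0n//.
have : e^-1 < (Num.bound e^-1)%:R by apply: archi_boundP; rewrite invr_ge0 ltW.
move=> /lt_le_trans; apply; rewrite ler_nat ltnW// ltnS.
by apply: leq_trans hn; rewrite leq_max leqnn orbT.
Qed.

Variables (T : choiceType) (Q : mean R T).

(* Bergelson's intersectivity lemma.  By Cauchy-Schwarz for the mean along [q],
   [psi E > 0] forces [psi (E `&` D k) > 0] for arbitrarily large [k]. *)
Lemma intersectivity (D : nat -> set T) :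
  0 < ulim q (fun n => Q (indic R (D n))) ->
  exists2 s : nat -> nat, forall n k, (n < k)%N -> (s n < s k)%N &
    forall k, 0 < Q (indic R [set g | forall j, (j <= k)%N -> D (s j) g]).
Proof.
have bi (E : nat -> set T) : bnd (fun n => Q (indic R (E n))).
  exists 1 => n; apply: norm_mean_le => g.
  by rewrite ger0_norm ?indic_ge0// indic_le1.
pose psi E := umean R Hq (fun n => Q (indic R (E `&` D n))).
have bpsi (E : nat -> set T) : bnd (fun n => psi (E n)).
  exists 1 => n; apply: norm_mean_le => k; apply: norm_mean_le => g.
  by rewrite ger0_norm ?indic_ge0// indic_le1.
have step (p : set T * nat) : exists k, 0 < psi p.1 -> (p.2 < k)%N /\ 0 < psi (p.1 `&` D k).
  have [p0|] := ltP 0 (psi p.1); last by exists 0%N.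
  have bx : bnd (fun z : nat * T => indic R (p.1 `&` D z.1) z.2).
    by exists 1 => z; rewrite ger0_norm ?indic_ge0// indic_le1.
  have := @mean_CS2 _ _ _ (umean R Hq) Q (fun n => indic R (p.1 `&` D n)) (fun=> 1) bx (bnd_cst _ 1).
  rewrite (_ : Q (fun=> 1 ^+ 2) = 1); last by rewrite expr1n mean_cst.
  rewrite mul1r (_ : umean R Hq (fun n => Q (fun z => 1 * indic R (p.1 `&` D n) z)) = psi p.1); last first.
    by apply: eq_mean => n; apply: eq_mean => z; rewrite mul1r.
  rewrite (_ : umean R Hq (fun x => umean R Hq _) = umean R Hq (fun n => psi (p.1 `&` D n))); last first.
    apply: eq_mean => n; apply: eq_mean => k; apply: eq_mean => z.
    rewrite /indic; case: asboolP => h1; case: asboolP => h2; case: asboolP => h3;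
      rewrite ?mulr1 ?mulr0//; exfalso.
    - by apply: h3; split => //; exact: h2.2.
    - by apply: h2; split; [exact: h3.1.1|exact: h3.2].
    - by apply: h1; exact: h3.1.
    - by apply: h1; exact: h3.1.
  move=> /(lt_le_trans (exprn_gt0 2 p0)) h.
  have hn : q [set k | (p.2 < k)%N] by apply: q_oo; exists p.2.+1.
  have [k /= pk k0] := umean_gt0_ex (bpsi (fun n => p.1 `&` D n)) h hn.
  by exists k.
have [F hF] := choice step.
move=> D0.
(* [S n] holds the intersection built so far, on which [psi] stays positive, and the last index
   used. *)
pose S := fix S n := if n is n'.+1 then ((S n').1 `&` D (F (S n')), F (S n')) else (setT, 0%N).
have S0 n : 0 < psi (S n).1.
  elim: n => [|n IH] /=; last by have [] := hF _ IH.
  rewrite /psi (eq_mean _ (g := fun n => Q (indic R (D n))))// => n.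
  by rewrite setTI.
pose s n := F (S n).
have s1 n : (s n < s n.+1)%N by have [] := hF _ (S0 n.+1).
exists s; [by move=> n k; exact: (homo_ltn ltn_trans s1)|move=> k].
have [n _ hn] := umean_gt0_ex (HU := Hq) (bi (fun n => (S k.+1).1 `&` D n))
  (S0 k.+1) (ultraT Hq).
apply: (lt_le_trans hn); apply: le_mean_indic => g [h _].
elim: k h {hn} => [|k IH] /= [h1 h2] j; first by rewrite leqn0 => /eqP ->.
by rewrite leq_eqVlt => /orP[/eqP -> //|]; apply: IH.
Qed.

End NaturalUltrafilter.

(** * Averages along the Folner sequence *)

Section FolnerMean.
Variables (R : realType) (G : choiceType).

Definition fset_mean (F : {fset G}) (F0 : F != fset0) : mean R G.
Proof.
refine (@Mean R G (fun g => (\sum_(x <- F) g x) / #|` F|%:R) _ _ _ _).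
- by move=> g h _ _; rewrite big_split mulrDl.
- by move=> c g _; rewrite -mulr_sumr mulrA.
- by move=> g _ g0; rewrite divr_ge0// sumr_ge0.
- rewrite big_const_seq count_predT iter_addr_0 divff//.
  by rewrite pnatr_eq0 cardfs_eq0.
Defined.

Lemma bnd_mean_family (I X : Type) (M : I -> mean R X) (g : X -> R) :
  bnd g -> bnd (fun i => M i g).
Proof. by move=> [C hC]; exists C => i; apply: norm_mean_le. Qed.

Definition mean_bind (I X : Type) (Q : mean R I) (M : I -> mean R X) : mean R X.
Proof.
refine (@Mean R X (fun g => Q (fun i => M i g)) _ _ _ _).
- move=> g h bg bh; rewrite -meanD; [ |exact: bnd_mean_family..].
  by apply: eq_mean => i; rewrite meanD.
- by move=> c g bg; rewrite -meanZ; [apply: eq_mean => i; rewrite meanZ|exact: bnd_mean_family].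
- by move=> g bg g0; apply: mean_ge0 => [|i]; [exact: bnd_mean_family|exact: mean_ge0].
- by rewrite -[RHS](mean1 Q); apply: eq_mean => i; rewrite mean1.
Defined.

Lemma sum_fset_diff (A B : {fset G}) (g : G -> R) C : (forall x, `|g x| <= C) ->
  `|\sum_(x <- A) g x - \sum_(x <- B) g x| <= C * #|` fsymdiff A B|%:R.
Proof.
move=> gC.
have bound (S : {fset G}) : `|\sum_(x <- S) g x| <= C * #|` S|%:R.
  apply: (le_trans (ler_norm_sum _ _ _)).
  have -> : C * #|` S|%:R = \sum_(x <- S) C.
    by rewrite big_const_seq count_predT iter_addr_0 mulr_natr.
  exact: ler_sum.
have sum_split (S S' : {fset G}) : \sum_(x <- S) g x =
    \sum_(x <- (S `&` S')%fset) g x + \sum_(x <- (S `\` S')%fset) g x.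
  rewrite (big_fsetID _ (fun x => x \in S') S) /=; congr (_ + _); apply: eq_fbigl => x.
    by rewrite !inE.
  by rewrite !inE andbC.
rewrite (sum_split A B) (sum_split B A) fsetIC opprD addrACA subrr add0r.
apply: (le_trans (ler_normB _ _)).
have -> : #|` fsymdiff A B| = (#|` (A `\` B)%fset| + #|` (B `\` A)%fset|)%N.
  rewrite /fsymdiff cardfsU (_ : _ `&` _ = fset0)%fset ?cardfs0 ?subn0//.
  by apply/fsetP => x; rewrite !inE; case: (x \in A); case: (x \in B).
by rewrite natrD mulrDr; apply: lerD.
Qed.

Lemma fset_mean_translate (F : {fset G}) (F0 : F != fset0) (t : G -> G) (g : G -> R) C :
  injective t -> (forall x, `|g x| <= C) ->
  `|fset_mean F0 (fun x => g (t x)) - fset_mean F0 g|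
    <= C * (#|` fsymdiff [fset t x | x in F]%fset F|%:R / #|` F|%:R).
Proof.
move=> tI gC /=; rewrite -mulrBl normrM mulrA.
rewrite [X in _ * X]ger0_norm; last by rewrite invr_ge0.
rewrite ler_wpM2r ?invr_ge0//.
have <- : \sum_(x <- [fset t x | x in F]%fset) g x = \sum_(x <- F) g (t x).
  by rewrite big_imfset//= => x y _ _ /tI.
exact: sum_fset_diff.
Qed.

Lemma fsymdiffC (A B : {fset G}) : fsymdiff A B = fsymdiff B A.
Proof. by rewrite /fsymdiff fsetUC. Qed.

Variables (mul : G -> G -> G) (one : G) (inv : G -> G).
Hypothesis Hgrp : is_group mul one inv.
Variables (q : set (set nat)) (Hq : is_ultrafilter q) (q_oo : \oo `<=` q).
Variables (Phi : nat -> {fset G}) (HPhi : two_sided_folner mul R Phi).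

Definition folner_mean : mean R G :=
  mean_bind (umean R Hq) (fun N => fset_mean (HPhi.1 N)).

(** The translation changes the [N]-th average by at most the bound of [g] times the Folner ratio,
    which tends to 0. *)
Lemma folner_mean_translate (t : G -> G) (g : G -> R) : injective t -> bnd g ->
  (fun N => (#|` fsymdiff [fset t x | x in Phi N]%fset (Phi N)|%:R / #|` Phi N|%:R : R))
    @ \oo --> (0 : R) ->
  folner_mean (fun x => g (t x)) = folner_mean g.
Proof.
move=> tI [C hC] /cvgrPdist_lt h0.
have bg : bnd g by exists C.
have E k : folner_mean k = umean R Hq (fun N => fset_mean (HPhi.1 N) k) by [].
apply/eqP; rewrite -subr_eq0 !E -meanB; first last.
- exact: bnd_mean_family.
- by apply: bnd_mean_family; bnd_tac.
apply/eqP/(is_ulimE Hq) => e e0; apply: q_oo.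
have C0 : 0 < `|C| + 1 by rewrite ltr_wpDl.
have := h0 _ (divr_gt0 e0 C0); apply: filterS => N /=.
rewrite sub0r normrN subr0 ltr_pdivlMr// => hN.
apply: le_lt_trans hN; rewrite [X in _ <= X]mulrC.
apply: (le_trans (fset_mean_translate (HPhi.1 N) tI hC)).
rewrite [X in _ <= _ * X]ger0_norm ?divr_ge0// ler_wpM2r ?divr_ge0//.
by apply: (le_trans (ler_norm _)); rewrite lerDl.
Qed.

Lemma folner_mean_linv g (p : G -> R) : bnd p ->
  folner_mean (fun x => p (mul g x)) = folner_mean p.
Proof.
move=> bp; apply: folner_mean_translate => //.
  by move=> x y h; rewrite -(grp_mulVK Hgrp g x) h (grp_mulVK Hgrp).
have [_ /(_ g)[_ h]] := HPhi.
rewrite (_ : (fun N => _) = (fun N : nat =>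
  (#|` fsymdiff (Phi N) (ltrans mul g (Phi N))|%:R / #|` Phi N|%:R : R))) //.
by apply/funext => N; rewrite fsymdiffC.
Qed.

Lemma folner_mean_rinv g (p : G -> R) : bnd p ->
  folner_mean (fun x => p (mul x g)) = folner_mean p.
Proof.
move=> bp; apply: (@folner_mean_translate (fun x => mul x g)) => //.
  move=> x y h; rewrite -(grp_mulr1 Hgrp x) -(grp_mulr1 Hgrp y) -(grp_mulrV Hgrp g).
  by rewrite !(grp_mulA Hgrp) h.
by have [_ /(_ g)[]] := HPhi.
Qed.

End FolnerMean.

(** * Points are null for an invariant mean on an infinite group *)

Section SingletonsNull.
Variables (R : realType) (G : choiceType).
Variables (mul : G -> G -> G) (one : G) (inv : G -> G).
Hypothesis Hgrp : is_group mul one inv.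
Variable m : mean R G.
Hypothesis linv : forall g (p : G -> R), bnd p -> m (fun x => p (mul g x)) = m p.

(** By left invariance all singletons have the same mean [a]; if it were positive, sufficiently many
    of them would have total mean above 1. *)
Lemma mean_singleton_null x : infinite_set [set: G] -> m (indic R [set x]) = 0.
Proof.
move=> Ginf; apply/eqP; rewrite eq_le mean_indic_ge0 andbT leNgt; apply/negP => x0.
set a := m _ in x0.
have same y : m (indic R [set y]) = a.
  rewrite /a -(linv (mul x (inv y)) (p := indic R [set x])); last by bnd_tac.
  apply: eq_mean => z; have [->|zy] := pselect (z = y).
    by rewrite !indic_in//= -(grp_mulA Hgrp) (grp_mulV Hgrp) (grp_mulr1 Hgrp).
  rewrite !indic_notin//= => h; apply: zy.
  rewrite -(grp_mul1 Hgrp z) -(grp_mulrV Hgrp y) -(grp_mulA Hgrp) -(grp_mulVK Hgrp x (mul (inv y) z)).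
  by rewrite (grp_mulA Hgrp x) h (grp_mulV Hgrp) (grp_mulr1 Hgrp).
have [B _ hB] := infinite_set_fset (Num.bound a^-1) Ginf.
have : m (fun z => \sum_(y <- B) indic R [set y] z) <= 1.
  apply: mean_le_cst => [|z]; first by bnd_tac.
  have [zB|zB] := boolP (z \in B).
    rewrite (big_fsetD1 z)//= indic_in// big1_seq ?addr0// => y /= /[!inE] /andP[yz _].
    by rewrite indic_notin//= => /eqP; rewrite eq_sym (negbTE yz).
  by rewrite big1_seq// => y /= yB; rewrite indic_notin//= => zy; rewrite zy yB in zB.
rewrite mean_sum; last by move=> y; bnd_tac.
under eq_bigr do rewrite same.
rewrite big_const_seq count_predT iter_addr_0 -mulr_natr.
have : a^-1 < (Num.bound a^-1)%:R by apply: archi_boundP; rewrite invr_ge0 ltW.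
have : (Num.bound a^-1)%:R <= #|` B|%:R :> R by rewrite ler_nat.
move=> h1 /lt_le_trans /(_ h1); rewrite invf_plt ?posrE//; last first.
  by apply: lt_le_trans h1; apply: le_lt_trans (archi_boundP _); rewrite invr_ge0 ltW.
by rewrite -[X in X < _]mul1r ltr_pdivrMr; [lra|apply: lt_le_trans h1; apply: le_lt_trans (archi_boundP _); rewrite invr_ge0 ltW].
Qed.

End SingletonsNull.

(** * Ultrafilters containing every conull set *)

Section UltrafilterOfMean.
Variables (R : realType) (T : choiceType) (Q : mean R T) (E : nat -> set T).
Hypothesis E_decr : forall n k, (n <= k)%N -> E k `<=` E n.
Hypothesis E_gt0 : forall n, 0 < Q (indic R (E n)).

(** The sets that contain some [E n] up to a null set form a filter, as the [E n] decrease, and it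
    is proper, as they have positive mean. Any ultrafilter above it will do. *)
Lemma ultrafilter_of_mean : exists p : set (set T),
  [/\ is_ultrafilter p, forall n, p (E n) & forall A, Q (indic R A) = 0 -> p (~` A)].
Proof.
pose F : set_system T := [set A | exists n, Q (indic R (E n `\` A)) = 0].
have FF : ProperFilter F.
  split.
    move=> [n]; rewrite setD0 => h; have := E_gt0 n; by rewrite h ltxx.
  split.
  - exists 0%N; rewrite setDT -[RHS](mean_cst Q); apply: eq_mean => x.
    by rewrite indic_notin.
  - move=> A B [n hn] [k hk]; exists (maxn n k).
    apply: le_mean_indic_null (mean_indicU_null hn hk) => x [Ex nAB].
    have [Ax|nA] := pselect (A x).
      right; split; first by apply: E_decr Ex; rewrite leq_maxr.
      by move=> Bx; apply: nAB.
    by left; split => //; apply: E_decr Ex; rewrite leq_maxl.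
  - move=> A B AB [n hn]; exists n; apply: le_mean_indic_null hn => x [Ex nB].
    by split => // /AB.
have [p [Hp Fp]] := is_ultrafilter_ex FF; exists p; split => //.
  move=> n; apply: Fp; exists n; rewrite setDv -[RHS](mean_cst Q); apply: eq_mean => x.
  by rewrite indic_notin.
move=> A A0; apply: Fp; exists 0%N; apply: le_mean_indic_null A0 => x [_] /= nA.
by apply: contrapT.
Qed.

End UltrafilterOfMean.

(** * Choice of the ultrafilter and of the first subsequence *)

Section Recurring.
Variables (R : realType) (G : countType).
Variables (mul : G -> G -> G) (one : G) (inv : G -> G).
Hypothesis Hgrp : is_group mul one inv.
Hypothesis Ginf : infinite_set [set: G].
Variables (q : set (set nat)) (Hq : is_ultrafilter q) (q_oo : \oo `<=` q).
Variables (Phi : nat -> {fset G}) (HPhi : two_sided_folner mul R Phi).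
Variable f : G -> R.
Hypothesis f01 : forall x, 0 <= f x <= 1.

Let bf : bnd f := bnd01 f01.
Let m := folner_mean Hq HPhi.
Let avg N := fset_mean R (HPhi.1 N).

(* Replacing the weight [Q] of [bohr_recurrence] by an ultrafilter [p] whose members
   all have positive [Q]-measure. *)
Lemma ultrafilter_recurrence e : 0 < e <= 1 ->
  exists (u : G -> R) (B : set G) (p : set (set G)) (s : nat -> nat),
  [/\ (forall x, 0 <= u x <= 1) /\ (forall n k, (n < k)%N -> (s n < s k)%N),
      is_ultrafilter p /\ non_principal p,
      forall n, p [set g | m f ^+ 2 - 2 * e <= avg (s n) (fun h => u h * f (mul h g))],
      (forall x y, (fun n => avg (s n) (fun z => (Rg mul x f z - u z) * (Rg mul y f z - u z)))
         @ \oo --> m (fun z => (Rg mul x f z - u z) * (Rg mul y f z - u z))) &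
      p B /\ forall x, B x -> p [set y |
         m (fun z => (Rg mul x f z - u z) * (Rg mul y f z - u z)) <= e]].
Proof.
move=> he; have /andP[e0 e1] := he.
have linv := folner_mean_linv Hgrp Hq q_oo HPhi.
have rinv := folner_mean_rinv Hgrp Hq q_oo HPhi.
have [u [Q [B [u01 Qnull QB hB hQ]]]] := bohr_recurrence Hgrp linv rinv f01 he.
have bu : bnd u := bnd01 u01.
have bR x : bnd (Rg mul x f) by rewrite /Rg; bnd_tac.
pose w N g := avg N (fun h => u h * f (mul h g)).
have w01 N g : 0 <= w N g <= 1.
  apply/andP; split; [apply: mean_ge0|apply: mean_le_cst]; try by bnd_tac.
    by move=> h; have /andP[? _] := u01 h; have /andP[? _] := f01 (mul h g); rewrite mulr_ge0.
  move=> h; have /andP[? ?] := u01 h; have /andP[? ?] := f01 (mul h g).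
  by rewrite mulr_ile1.
have bw N : bnd (w N) := bnd01 (w01 N).
set t := m f ^+ 2 - e in hQ.
pose D N : set G := [set g | t - e <= w N g].
have bQD : bnd (fun N => Q (indic R (D N))).
  by exists 1 => N; apply: norm_mean_le => g; rewrite ger0_norm ?indic_ge0 ?indic_le1.
(* Markov's inequality: [K] bounds [w N - (t - e)] from above, while the limit along [q] of
   [Q (w N)] is at least [t]. Here [Q] commutes with [avg N] because the latter is a finite sum. *)
have QD : 0 < ulim q (fun N => Q (indic R (D N))).
  pose K := 1 + `|t| + e.
  have K0 : 0 < K by rewrite ltr_wpDl// addr_ge0.
  have Qw N : Q (w N) = avg N (fun h => u h * Q (fun g => f (mul h g))).
    rewrite /w /avg /= meanZr; last by apply: bnd_sum => h; bnd_tac.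
    congr (_ / _); rewrite mean_sum; last by move=> h; bnd_tac.
    by apply: eq_bigr => h _; rewrite meanZ; last by bnd_tac.
  have QK N : Q (w N) <= (t - e) + K * Q (indic R (D N)).
    rewrite -[X in X + _](mean_cst Q) -meanZ -?meanD; [ |bnd_tac..].
    apply: le_mean => [||g]; [exact: bw|bnd_tac|].
    have /andP[? ?] := w01 N g; have [Dg|nDg] := pselect (D N g).
      by rewrite indic_in// mulr1 /K; have := ler_norm (- t); rewrite normrN; lra.
    by rewrite indic_notin// mulr0 addr0; move: nDg => /negP; rewrite /D /= -ltNge => /ltW.
  have : t <= (t - e) + K * umean R Hq (fun N => Q (indic R (D N))).
    apply: (le_trans hQ).
    rewrite -[X in X + _](mean_cst (umean R Hq)) -meanZ -?meanD; [ |bnd_tac..].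
    apply: (@le_mean _ _ (umean R Hq)
      (fun N => avg N (fun h => u h * Q (fun g => f (mul h g))))) => [||N].
    - by apply: bnd_mean_family; bnd_tac.
    - by bnd_tac.
    - by rewrite -Qw; exact: QK.
  move=> h; have : 0 < K * umean R Hq (fun N => Q (indic R (D N))) by lra.
  by rewrite pmulr_rgt0.
(* One extraction makes all the inner products converge and, through [None], keeps the limit of
   [Q (D N)] positive along the subsequence, as intersectivity requires. *)
pose X (i : option (G * G)) N := if i is Some xy then
  avg N (fun z => (Rg mul xy.1 f z - u z) * (Rg mul xy.2 f z - u z)) else Q (indic R (D N)).
have bX i : bnd (X i).
  by case: i => [xy|]//; apply: bnd_mean_family; bnd_tac.
have [s s_incr hs] := diagonal_subsequence Hq q_oo bX.
have QDs : 0 < ulim q (fun n => Q (indic R (D (s n)))).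
  by rewrite (cvg_ulim Hq q_oo (hs None)).
have [s' s'_incr hs'] := intersectivity Hq q_oo QDs.
pose E k : set G := [set g | forall j, (j <= k)%N -> D (s (s' j)) g].
have Edecr n k : (n <= k)%N -> E k `<=` E n.
  by move=> nk g h j jn; apply: h; exact: leq_trans nk.
have [p [Hp pE pQ]] := ultrafilter_of_mean Edecr hs'.
exists u, B, p, (s \o s'); split.
- by split=> // n k nk; apply: s_incr; exact: s'_incr.
(* Singletons are [m]-null because [G] is infinite, hence [Q]-null, so [p] contains their
   complements. *)
- split=> // x px.
  have := pQ _ (Qnull _ (mean_singleton_null Hgrp linv x Ginf)) => px'.
  by apply: (ultra0 Hp); rewrite -(setICr [set x]); exact: (ultraI Hp).
- move=> n; apply: (ultraS Hp) (pE n) => g h.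
  have hw : t - e <= w (s (s' n)) g := h n (leqnn n).
  by change (m f ^+ 2 - 2 * e <= w (s (s' n)) g); rewrite /t in hw; lra.
- move=> x y.
  exact: (cvg_increasing s'_incr (hs (Some (x, y)))).
split; first by have := pQ _ QB; rewrite setCK.
move=> x /hB /Qnull /pQ; apply: (ultraS Hp) => y /= /negP.
by rewrite -leNgt.
Qed.

(** The limit along [p] commutes with a finite average. *)
Lemma fset_mean_sum_ulim (p : set (set G)) (Hp : is_ultrafilter p) N (u : G -> R) c :
  bnd u -> p [set g | c <= avg N (fun h => u h * f (mul h g))] ->
  c <= avg N (fun h => u h * Rp mul p f h).
Proof.
move=> bu hc.
have -> : avg N (fun h => u h * Rp mul p f h) =
    umean R Hp (fun g => avg N (fun h => u h * f (mul h g))).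
  rewrite /avg [RHS]meanZr; last by apply: bnd_sum => h; bnd_tac.
  congr (_ / _); rewrite mean_sum; last by move=> h; bnd_tac.
  by apply: eq_bigr => h _; rewrite meanZ; last by bnd_tac.
by apply: (ulim_ge Hp) => //; bnd_tac.
Qed.

End Recurring.

(** * Means that extend limits of averages *)

Section AverageLimits.
Variables (R : realType) (G : choiceType) (q : set (set nat)).
Hypotheses (Hq : is_ultrafilter q) (q_oo : \oo `<=` q).
Variable (Psi : nat -> {fset G}).
Hypothesis Psi0 : forall N, Psi N != fset0.

(** The limit along [q] also covers functions whose averages over [Psi] are not known to
    converge. *)
Definition limit_mean : mean R G := mean_bind (umean R Hq) (fun N => fset_mean R (Psi0 N)).

Lemma limit_meanE (g : G -> R) l :
  (fun N => fset_mean R (Psi0 N) g) @ \oo --> l -> limit_mean g = l.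
Proof. exact: (cvg_ulim Hq q_oo). Qed.

Lemma inner_limit_mean (g h : G -> R) : inner_exists Psi g h ->
  inner Psi g h = limit_mean (fun x => g x * h x).
Proof. by move=> /cvg_ex[l hl]; rewrite (limit_meanE hl); apply/cvg_lim. Qed.

End AverageLimits.

Lemma avg_inner_indic (R : realType) (G : choiceType) (Phi : nat -> {fset G}) (A : set G) N :
  avg_inner Phi (fun _ => 1) (indic R A) N =
  #|` [fset x in Phi N | `[< A x >]]%fset|%:R / #|` Phi N|%:R.
Proof.
rewrite /avg_inner; congr (_ / _).
under eq_bigr do rewrite mul1r.
rewrite (big_fsetID _ (fun x => `[< A x >])) /= [X in _ + X]big1_seq ?addr0; last first.
  by move=> x /= /[!inE] /andP[_ /negbTE Ax]; rewrite /indic Ax.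
rewrite (eq_big_seq (fun=> 1)) ?big_const_seq ?count_predT ?iter_addr_0//.
by move=> x /= /[!inE] /andP[_ Ax]; rewrite /indic Ax.
Qed.

Theorem theorem5p3 (R : realType) (G : countType)
    (mul : G -> G -> G) (one : G) (inv : G -> G)
    (Hgrp : is_group mul one inv)
    (Hinf : infinite_set [set: G])
    (Hamen : amenable mul R)
    (A : set G) (Phi : nat -> {fset G})
    (HPhi : two_sided_folner mul R Phi)
    (HdA : density_exists R Phi A)
    (eps : R) (Heps : 0 < eps) :
  exists (Psi : nat -> {fset G}) (p : set (set G)),
    [/\ subsequence Psi Phi, is_ultrafilter p, non_principal p,
        forall g : G, inner_exists Psi (Rg mul g (indic R A)) (Rp mul p (indic R A)) &
        ulim p (fun g => inner Psi (Rg mul g (indic R A)) (Rp mul p (indic R A)))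
          >= (inner Psi (fun _ => 1) (indic R A)) ^+ 2 - eps].
Proof.
set f := indic R A.
have f01 x : 0 <= f x <= 1 := indic_itv R A x.
have bf : bnd f := bnd01 f01.
have [q [Hq q_oo]] := is_ultrafilter_ex (eventually_filter : ProperFilter \oo).
(* The recurrence loses [2 * e] and the final Cauchy-Schwarz the square root [e1] of [e]; as
   [e <= e1], the total is at most [3 * e1], below [eps]. *)
pose e1 := Num.min 1 (eps / 4); pose e := e1 ^+ 2.
have e10 : 0 < e1 by rewrite lt_min ltr01 divr_gt0.
have e11 : e1 <= 1 by rewrite ge_min lexx.
have e1e : e1 <= eps / 4 by rewrite ge_min lexx orbT.
have ee1 : e <= e1 by rewrite /e expr2 ler_piMl// ltW.
have he : 0 < e <= 1 by rewrite exprn_gt0//=; exact: le_trans e11.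
have [u [B [p [s [[u01 s_incr] [Hp np] hpD hcorr [pB hB]]]]]] :=
  ultrafilter_recurrence Hgrp Hinf Hq q_oo HPhi f01 he.
have bu : bnd u := bnd01 u01.
have bR x : bnd (Rg mul x f) by rewrite /Rg; bnd_tac.
pose b := Rp mul p f.
have b01 h : 0 <= b h <= 1.
  rewrite /b /Rp; change (0 <= umean R Hp (fun g => f (mul h g)) <= 1).
  apply/andP; split; [apply: mean_ge0|apply: mean_le_cst]; try by bnd_tac.
    by move=> g; have /andP[] := f01 (mul h g).
  by move=> g; have /andP[] := f01 (mul h g).
have bb : bnd b := bnd01 b01.
have bX g : bnd (fun n => fset_mean R (HPhi.1 (s n)) (fun h => Rg mul g f h * b h)).
  by apply: bnd_mean_family; bnd_tac.
(* A second extraction makes the inner products with [b] converge; it has to follow the choice of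
   [p], on which [b] depends. *)
have [s' s'_incr hs'] := diagonal_subsequence Hq q_oo bX.
pose Psi n := Phi (s (s' n)).
have Psi0 n : Psi n != fset0 := HPhi.1 (s (s' n)).
have ss'_incr n k : (n < k)%N -> ((s \o s') n < (s \o s') k)%N.
  by move=> nk; apply: s_incr; exact: s'_incr.
have ex g : inner_exists Psi (Rg mul g f) b by apply/cvg_ex; eexists; exact: (hs' g).
exists Psi, p; split => //.
  by exists (s \o s').
pose m := folner_mean Hq HPhi; pose mu := limit_mean R Hq Psi0.
(* The density exists along all of [Phi], so the subsequence and the ultrafilter [q] give the same
   value. *)
have dens : inner Psi (fun=> 1) f = m f.
  have /cvg_ex[d hd] : cvgn (avg_inner Phi (fun=> 1) f).
    by have -> := funext (avg_inner_indic R Phi A).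
  have -> : inner Psi (fun=> 1) f = d by apply/cvg_lim => //; exact: (cvg_increasing ss'_incr hd).
  rewrite -(cvg_ulim Hq q_oo hd); apply: (@eq_mean _ _ (umean R Hq)) => N.
  by rewrite /avg_inner /=; congr (_ / _); apply: eq_bigr => x _; rewrite mul1r.
rewrite dens.
have -> : ulim p (fun g => inner Psi (Rg mul g f) b) =
    umean R Hp (fun g => mu (fun x => Rg mul g f x * b x)).
  by apply: (@eq_mean _ _ (umean R Hp)) => g; exact: inner_limit_mean.
(* The bound holds at every index, so it passes to [mu] whether or not these averages converge. *)
have ub : m f ^+ 2 - 2 * e <= mu (fun z => u z * b z).
  apply: (@mean_ge_cst _ _ (umean R Hq)); first by apply: bnd_mean_family; bnd_tac.
  by move=> n; exact: (fset_mean_sum_ulim f01 Hp bu (hpD (s' n))).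
have mumu x y : mu (fun z => (Rg mul x f z - u z) * (Rg mul y f z - u z)) =
    m (fun z => (Rg mul x f z - u z) * (Rg mul y f z - u z)).
  by apply: (limit_meanE Hq q_oo); exact: (cvg_increasing s'_incr (hcorr x y)).
have bxi : bnd (fun c : G * G => Rg mul c.1 f c.2 - u c.2) by rewrite /Rg; bnd_tac.
(* For [x] in [B] and then [p]-almost every [y], the inner product of [R^x f - u] and [R^y f - u] is
   at most [e], the square of [e1]. Since [B] belongs to [p], this bounds the iterated limit in
   [mean_CS2]. *)
have CS : `|umean R Hp (fun g => mu (fun z => b z * (Rg mul g f z - u z)))| <= e1.
  apply: norm_le_of_sqr; first exact: ltW.
  apply: (le_trans (mean_CS2 (umean R Hp) mu bxi bb)).
  rewrite -/e -[X in _ <= X]mul1r; apply: ler_pM.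
  - by apply: mean_ge0 => [|z]; [bnd_tac|exact: sqr_ge0].
  - exact: mean2_ge0 bxi.
  - apply: mean_le_cst => [|z]; first by bnd_tac.
    by have /andP[? ?] := b01 z; rewrite expr_le1.
  apply: (mean_le_off_null _ (umean_indic_null R Hp pB)); first by rewrite /Rg; bnd_tac.
  move=> x /contrapT Bx.
  apply: (mean_le_off_null _ (umean_indic_null R Hp (hB x Bx))); first by rewrite /Rg; bnd_tac.
  by move=> y /contrapT h; cbv beta; rewrite mumu.
have E : umean R Hp (fun g => mu (fun z => b z * (Rg mul g f z - u z))) =
    umean R Hp (fun g => mu (fun x => Rg mul g f x * b x)) - mu (fun z => u z * b z).
  rewrite -[X in _ = _ - X](mean_cst (umean R Hp)) -meanB; [ |rewrite /Rg; bnd_tac..].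
  apply: eq_mean => x; rewrite -meanB; [ |bnd_tac..].
  by apply: eq_mean => z; ring.
move: CS; rewrite E ler_norml => /andP[h1 _]; lra.
Qed.
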